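(* Let $T\geq d_0+1$, let $\hat{\mathcal H}_T\in\mathcal M_{Tp\times Tr}(\mathbb R)$ and $\xi>0$, and let $\check d_\xi$ be the number of singular values of $\hat{\mathcal H}_T$ that are at least $2\xi$. Suppose that $\check d_\xi=d_0$ and that $$|\hat{\mathcal H}_T-Hg_0^*|_{S_\infty}\wedge|\hat{\mathcal H}_T-Hg_0^*|_{S_2}\leq\frac{(\sqrt2-1)^{1/2}\,s_{d_0}(\bar{\mathcal O}^+)\,s_{d_0}^{1/2}(Hg_0^* )}{2\sqrt2}.$$ Then there exists an orthonormal matrix $R$ such that all of the following hold. (i) $\displaystyle |\hat{\mathcal O}-\bar{\mathcal O}R|_{S_2}^2+|\hat{\mathcal C}-R^*\bar{\mathcal C}|_{S_2}^2\leq\frac{2}{\sqrt2-1}\,\frac{|\hat{\mathcal H}_{\check d_\xi}-Hg_0^*|_{S_2}^2}{s_{d_0}(Hg_0^* )}.$ (ii) $\displaystyle |\hat C-\bar CR|_{S_2}^2+|\hat B-R^*\bar B|_{S_2}^2\leq\frac{2}{\sqrt2-1}\,\frac{|\hat{\mathcal H}_{\check d_\xi}-Hg_0^*|_{S_2}^2}{s_{d_0}(Hg_0^* )}.$ (iii) $\displaystyle |\hat A-R^*\bar AR|_{S_2}\leq\frac{2^{3/2}\left(1+|\bar A|_{S_\infty}\right)}{(\sqrt2-1)^{1/2}\,s_{d_0}(\bar{\mathcal O}^+)\,s_{d_0}^{1/2}(Hg_0^* )}\,|\hat{\mathcal H}_{\check d_\xi}-Hg_0^*|_{S_2}.$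
   Context: Notation: $a\wedge b=\min(a,b)$, $^*$ is transpose, $\mathcal M_{m\times n}(\mathbb R)$ the real $m\times n$ matrices, $s_k(M)$ the $k$-th singular value in decreasing order, $|\cdot|_{S_2}$ the Hilbert–Schmidt norm, $|\cdot|_{S_\infty}$ the operator norm, $M^\dagger$ the (left) pseudo-inverse, $M_{a:b,c:d}$ the submatrix of rows $a$ to $b$ and columns $c$ to $d$. Let $A_0\in\mathcal M_{d_0\times d_0}(\mathbb R)$, $B_0\in\mathcal M_{d_0\times r}(\mathbb R)$, $C_0\in\mathcal M_{p\times d_0}(\mathbb R)$ be a minimal realization, i.e. $d_0$ is the smallest state dimension among all triples $(A,B,C)$ with $CA^iB=C_0A_0^iB_0$ for all $i\geq0$. Let $g_0=[C_0B_0,C_0A_0B_0,\dots,C_0A_0^{2T-2}B_0]$ and let $Hg_0^*\in\mathcal M_{Tp\times Tr}(\mathbb R)$ be the block Hankel matrix whose $(i,j)$ block is $C_0A_0^{i+j-2}B_0$, $1\leq i,j\leq T$; it has rank $d_0$. Balanced minimal realization: let $Hg_0^*=U_0\Sigma_0V_0^*$ be the SVD with $\Sigma_0\in\mathcal M_{d_0\times d_0}(\mathbb R)$, and set $\bar{\mathcal O}=U_0\Sigma_0^{1/2}\in\mathcal M_{Tp\times d_0}(\mathbb R)$, $\bar{\mathcal C}=\Sigma_0^{1/2}V_0^*\in\mathcal M_{d_0\times Tr}(\mathbb R)$, $\bar{\mathcal O}^+=\bar{\mathcal O}_{1:p(T-1),1:d_0}$, and $$\bar A=(\bar{\mathcal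 O}^+)^\dagger\,\bar{\mathcal O}_{p+1:pT,1:d_0},\qquad \bar B=\bar{\mathcal C}_{1:d_0,1:r},\qquad \bar C=\bar{\mathcal O}_{1:p,1:d_0}.$$ Estimates: let $\hat{\mathcal H}_{\check d_\xi}=\hat U_\xi\hat\Sigma_\xi\hat V_\xi^*$ be the SVD of $\hat{\mathcal H}_T$ truncated to its $\check d_\xi$ largest singular values ($\hat\Sigma_\xi$ of size $\check d_\xi\times\check d_\xi$), and set $\hat{\mathcal O}=\hat U_\xi\hat\Sigma_\xi^{1/2}$, $\hat{\mathcal C}=\hat\Sigma_\xi^{1/2}\hat V_\xi^*$, $$\hat A=(\hat{\mathcal O}_{1:p(T-1),1:\check d_\xi})^\dagger\,\hat{\mathcal O}_{p+1:pT,1:\check d_\xi},\qquad \hat B=\hat{\mathcal C}_{1:\check d_\xi,1:r},\qquad \hat C=\hat{\mathcal O}_{1:p,1:\check d_\xi}.$$ *)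

(* Defs.v *)
From mathcomp Require Import all_boot all_order all_algebra.
From mathcomp Require Import polyrcf.
From mathcomp Require Import boolp classical_sets reals.

Set Implicit Arguments.
Unset Strict Implicit.
Unset Printing Implicit Defensive.

Import Order.TTheory GRing.Theory Num.Theory.
Local Open Scope ring_scope.

(* Singular values with multiplicity, in nonincreasing order: square roots of
   the eigenvalues of the n x n matrix M^T M.  The list has n entries, so for
   m < n it ends with n - m extra zeros beyond the usual minn m n values. *)
Definition singular_values (R : realType) m n (M : 'M[R]_(m, n)) : seq R :=
  let chi := char_poly (M^T *m M) in
  flatten [seq nseq (mup x chi) (Num.sqrt x) | x <- rev (rootsR chi)].

(* k is 1-based. *)
Definition singular_value (R : realType) m n (k : nat) (M : 'M[R]_(m, n)) : R :=
  nth 0 (singular_values M) k.-1.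

(* On column vectors this is the Euclidean norm; the norm `|M| that
   MathComp-Analysis puts on matrices is the max norm. *)
Definition hsnorm (R : realType) m n (M : 'M[R]_(m, n)) : R :=
  Num.sqrt (\sum_(i < m) \sum_(j < n) M i j ^+ 2).

Definition opnorm (R : realType) m n (M : 'M[R]_(m, n)) : R :=
  sup [set hsnorm (M *m x) | x in [set x : 'cV[R]_n | hsnorm x <= 1]]%classic.

(* The Penrose equations; they have exactly one solution X.  If M has full
   column rank, X is the left inverse (M^T M)^-1 M^T.  The library's pinvmx is
   a different (non-canonical) partial inverse. *)
Definition is_pseudo_inverse (R : realType) m n
    (M : 'M[R]_(m, n)) (X : 'M[R]_(n, m)) : Prop :=
  [/\ M *m X *m M = M, X *m M *m X = X,
      (M *m X)^T = M *m X & (X *m M)^T = X *m M].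

Definition pseudo_inverse (R : realType) m n (M : 'M[R]_(m, n)) :
    'M[R]_(n, m) :=
  xget 0 [set X | is_pseudo_inverse M X]%classic.

(* Thin or compact SVD M = U diag(s) V^T with q >= rank M singular values,
   some of which may vanish. *)
Definition is_svd (R : realType) m n q (M : 'M[R]_(m, n))
    (U : 'M[R]_(m, q)) (s : 'rV[R]_q) (V : 'M[R]_(n, q)) : Prop :=
  [/\ U^T *m U = 1%:M, V^T *m V = 1%:M,
      forall i, 0 <= s 0 i,
      forall i j : 'I_q, (i <= j)%N -> s 0 j <= s 0 i
    & M = U *m diag_mx s *m V^T].

(* (U, s, V) consists of the leading k terms of some SVD of M. *)
Definition is_truncated_svd (R : realType) m n k (M : 'M[R]_(m, n))
    (U : 'M[R]_(m, k)) (s : 'rV[R]_k) (V : 'M[R]_(n, k)) : Prop :=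
  exists (l : nat) (U' : 'M[R]_(m, l)) (s' : 'rV[R]_l) (V' : 'M[R]_(n, l)),
    is_svd M (row_mx U U') (row_mx s s') (row_mx V V').

Definition markov (R : realType) d r p (A : 'M[R]_d) (B : 'M[R]_(d, r))
    (C : 'M[R]_(p, d)) (k : nat) : 'M[R]_(p, r) :=
  C *m A ^+ k *m B.

Definition minimal_realization (R : realType) d0 r p (A0 : 'M[R]_d0)
    (B0 : 'M[R]_(d0, r)) (C0 : 'M[R]_(p, d0)) : Prop :=
  forall d (A : 'M[R]_d) (B : 'M[R]_(d, r)) (C : 'M[R]_(p, d)),
    (forall k, markov A B C k = markov A0 B0 C0 k) -> (d0 <= d)%N.

Lemma sum_ord_const (T n : nat) : (\sum_(i < T) n)%N = (T * n)%N.
Proof. by rewrite sum_nat_const card_ord. Qed.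

(* Blocks are indexed from 0, hence the exponent i + j. *)
Definition block_hankel (R : realType) d r p (T : nat) (A : 'M[R]_d)
    (B : 'M[R]_(d, r)) (C : 'M[R]_(p, d)) : 'M[R]_(T * p, T * r) :=
  castmx (sum_ord_const T p, sum_ord_const T r)
    (\mxblock_(i < T, j < T) markov A B C (i + j)).

(* Rows a + 1, ..., a + m' (1-based) of M, padded with zero rows if a + m'
   exceeds m, which does not happen below for 0 < T. *)
Definition subrows (R : realType) m n (a m' : nat) (M : 'M[R]_(m, n)) :
    'M[R]_(m', n) :=
  \matrix_(i < m', j < n)
    (if insub (a + i)%N is Some i' then M (i' : 'I_m) j else 0).

Definition subcols (R : realType) m n (a n' : nat) (M : 'M[R]_(m, n)) :
    'M[R]_(m, n') :=
  (subrows a n' M^T)^T.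

Definition obs_factor (R : realType) m q (U : 'M[R]_(m, q)) (s : 'rV[R]_q) :
    'M[R]_(m, q) :=
  U *m diag_mx (map_mx Num.sqrt s).

Definition ctrl_factor (R : realType) n q (s : 'rV[R]_q) (V : 'M[R]_(n, q)) :
    'M[R]_(q, n) :=
  diag_mx (map_mx Num.sqrt s) *m V^T.

Definition obs_plus (R : realType) p T q (O : 'M[R]_(T * p, q)) :
    'M[R]_(T.-1 * p, q) :=
  subrows 0 (T.-1 * p) O.

Definition realize_A (R : realType) p T q (O : 'M[R]_(T * p, q)) : 'M[R]_q :=
  pseudo_inverse (obs_plus O) *m subrows p (T.-1 * p) O.

Definition realize_B (R : realType) r T q (C : 'M[R]_(q, T * r)) :
    'M[R]_(q, r) :=
  subcols 0 r C.

Definition realize_C (R : realType) p T q (O : 'M[R]_(T * p, q)) :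
    'M[R]_(p, q) :=
  subrows 0 p O.

(* Main.v *)
(** Statement (i) is a Procrustes estimate.  Stack [Z = [O; C^T]] for both
    factorizations and let [Q] be the orthogonal polar factor of [Zbar^T Zhat].
    Since [Zbar^T Zbar = 2 Sigma_0] and, by [2ab <= a^2 + b^2],
    [|Zhat Zhat^T - Zbar Zbar^T|^2 <= 4 |Hxi - H0|^2], this gives (i) even with
    [1 / (sqrt 2 - 1)] in place of [2 / (sqrt 2 - 1)].

    For (iii) write [Ahat - Q^T Abar Q] as the pseudo-inverse of [Ohat+] applied to
    quantities controlled by (i).  The hypothesis only bounds [Hhat - H0] in
    operator norm, so (i) cannot be used to bound [Ohat+] from below.  Instead, with
    [v = Vhat Shat^(-1/2) x] and [u = Uhat Shat^(-1/2) x], one has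
    [Ohat x = H0 v + (Hhat - H0) v], hence [|Ohat+ x| >= sO |Cbar v| - eps |v|], while
    [|Cbar v| |Obar^T u| >= <H0 v, u> >= (1 - delta) |x|^2] and
    [|Obar^T u|^2 <= (1 + delta) |x|^2] by an eigenvector argument, where
    [delta = eps / s_d(Hhat)].  The resulting lower bound [0.358 sO |x|] just beats
    the required [sO |x| / (2 sqrt 2)].

    The cases [sH = 0] and [sO = 0] force [Hhat = H0]: the first contradicts the
    count of the singular values above [2 xi], the second makes everything exact. *)

Require Import Defs.
From mathcomp Require Import all_boot all_order all_algebra.
From mathcomp Require Import reals.
From mathcomp Require Import polyrcf ring lra.
From mathcomp Require Import boolp classical_sets topology normedtype derive.

Set Implicit Arguments.
Unset Strict Implicit.
Unset Printing Implicit Defensive.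

Import Order.TTheory GRing.Theory Num.Theory.
Import numFieldTopology.Exports numFieldNormedType.Exports.
Local Open Scope ring_scope.

(** * Hilbert-Schmidt inner product and norm *)

(** The trace form turns the adjunction rules [hsdot_mull] and [hsdot_mulr] into mere rearrangements
    of products. *)
Definition hsdot (R : realType) m n (A B : 'M[R]_(m, n)) : R := \tr (A^T *m B).

Section HilbertSchmidt.
Variable R : realType.

Lemma hsdotE m n (A B : 'M[R]_(m, n)) :
  hsdot A B = \sum_(i < m) \sum_(j < n) A i j * B i j.
Proof.
rewrite exchange_big; apply: eq_bigr => j _; rewrite mxE.
by apply: eq_bigr => i _; rewrite !mxE.
Qed.

Lemma hsdotC m n (A B : 'M[R]_(m, n)) : hsdot A B = hsdot B A.
Proof. by rewrite /hsdot -mxtrace_tr trmx_mul trmxK. Qed.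

Lemma hsdotDl m n (A B C : 'M[R]_(m, n)) :
  hsdot (A + B) C = hsdot A C + hsdot B C.
Proof. by rewrite /hsdot linearD mulmxDl mxtraceD. Qed.

Lemma hsdotDr m n (A B C : 'M[R]_(m, n)) :
  hsdot A (B + C) = hsdot A B + hsdot A C.
Proof. by rewrite /hsdot mulmxDr mxtraceD. Qed.

Lemma hsdotZl m n a (A B : 'M[R]_(m, n)) : hsdot (a *: A) B = a * hsdot A B.
Proof. by rewrite /hsdot linearZ -scalemxAl mxtraceZ. Qed.

Lemma hsdotZr m n a (A B : 'M[R]_(m, n)) : hsdot A (a *: B) = a * hsdot A B.
Proof. by rewrite hsdotC hsdotZl hsdotC. Qed.

Lemma hsdotNl m n (A B : 'M[R]_(m, n)) : hsdot (- A) B = - hsdot A B.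
Proof. by rewrite -scaleN1r hsdotZl mulN1r. Qed.

Lemma hsdotNr m n (A B : 'M[R]_(m, n)) : hsdot A (- B) = - hsdot A B.
Proof. by rewrite hsdotC hsdotNl hsdotC. Qed.

Lemma hsdot_mull m n k (M : 'M[R]_(m, k)) (A : 'M_(k, n)) (B : 'M_(m, n)) :
  hsdot (M *m A) B = hsdot A (M^T *m B).
Proof. by rewrite /hsdot trmx_mul mulmxA. Qed.

Lemma hsdot_mulr m n k (A : 'M[R]_(m, k)) (M : 'M_(k, n)) (B : 'M_(m, n)) :
  hsdot (A *m M) B = hsdot A (B *m M^T).
Proof. by rewrite /hsdot trmx_mul -mulmxA mxtrace_mulC !mulmxA. Qed.

Lemma hsdot_tr m n (A B : 'M[R]_(m, n)) : hsdot A^T B^T = hsdot A B.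
Proof. by rewrite [RHS]hsdotC /hsdot trmxK mxtrace_mulC. Qed.

Lemma hsdot_ge0 m n (A : 'M[R]_(m, n)) : 0 <= hsdot A A.
Proof.
rewrite hsdotE; apply: sumr_ge0 => i _; apply: sumr_ge0 => j _.
by rewrite -expr2 sqr_ge0.
Qed.

Lemma hsdot_eq0 m n (A : 'M[R]_(m, n)) : hsdot A A = 0 -> A = 0.
Proof.
move=> A0; apply/matrixP => i j; apply/eqP; rewrite mxE -sqrf_eq0 expr2.
have A2_ge0 k l : 0 <= A k l * A k l by rewrite -expr2 sqr_ge0.
move: A0; rewrite hsdotE => /eqP.
rewrite psumr_eq0 => [/allP/(_ i)|k _]; last by apply: sumr_ge0.
rewrite mem_index_enum psumr_eq0 // => /(_ isT)/allP/(_ j).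
by rewrite mem_index_enum => /(_ isT).
Qed.

Lemma hsnorm_ge0 m n (A : 'M[R]_(m, n)) : 0 <= hsnorm A.
Proof. exact: sqrtr_ge0. Qed.

Lemma hsnorm_sqr m n (A : 'M[R]_(m, n)) : hsnorm A ^+ 2 = hsdot A A.
Proof.
rewrite sqr_sqrtr => [|]; last first.
  by apply: sumr_ge0 => i _; apply: sumr_ge0 => j _; rewrite sqr_ge0.
by rewrite hsdotE; under eq_bigr do under eq_bigr do rewrite expr2.
Qed.

Lemma hsnorm_le m n m' n' (A : 'M[R]_(m, n)) (B : 'M[R]_(m', n')) :
  (hsnorm A <= hsnorm B) = (hsdot A A <= hsdot B B).
Proof. by rewrite -!hsnorm_sqr ler_sqr // nnegrE hsnorm_ge0. Qed.

Lemma hsnorm_eq m n m' n' (A : 'M[R]_(m, n)) (B : 'M[R]_(m', n')) :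
  hsdot A A = hsdot B B -> hsnorm A = hsnorm B.
Proof. by move=> AB; apply: le_anti; rewrite !hsnorm_le AB lexx. Qed.

Lemma hsnorm0 m n : hsnorm (0 : 'M[R]_(m, n)) = 0.
Proof.
by apply/eqP; rewrite -sqrf_eq0 hsnorm_sqr /hsdot mulmx0 mxtrace0.
Qed.

Lemma hsnorm_eq0 m n (A : 'M[R]_(m, n)) : hsnorm A = 0 -> A = 0.
Proof. by move=> A0; apply: hsdot_eq0; rewrite -hsnorm_sqr A0 expr0n. Qed.

Lemma hsnorm_gt0 m n (A : 'M[R]_(m, n)) : A != 0 -> 0 < hsnorm A.
Proof.
rewrite lt_def hsnorm_ge0 andbT; apply: contra => /eqP/hsnorm_eq0->.
exact: eqxx.
Qed.

Lemma hsnormN m n (A : 'M[R]_(m, n)) : hsnorm (- A) = hsnorm A.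
Proof. by apply: hsnorm_eq; rewrite hsdotNl hsdotNr opprK. Qed.

Lemma hsnormZ m n a (A : 'M[R]_(m, n)) : 0 <= a -> hsnorm (a *: A) = a * hsnorm A.
Proof.
move=> a_ge0; apply: (@pexpIrn _ 2) => //; rewrite ?nnegrE ?mulr_ge0 ?hsnorm_ge0//.
by rewrite exprMn !hsnorm_sqr hsdotZl hsdotZr mulrA.
Qed.

Lemma hsnorm_tr m n (A : 'M[R]_(m, n)) : hsnorm A^T = hsnorm A.
Proof. by apply: hsnorm_eq; rewrite hsdot_tr. Qed.

Lemma hsdot_le m n (A B : 'M[R]_(m, n)) : hsdot A B <= hsnorm A * hsnorm B.
Proof.
have [->|/hsnorm_gt0 A_gt0] := eqVneq A 0.
  by rewrite hsnorm0 mul0r /hsdot trmx0 mul0mx mxtrace0.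
have [->|/hsnorm_gt0 B_gt0] := eqVneq B 0.
  by rewrite hsnorm0 mulr0 /hsdot mulmx0 mxtrace0.
(* Cauchy-Schwarz: the expanded square is [2 |A| |B| (|A| |B| - hsdot A B)]. *)
have := hsdot_ge0 (hsnorm B *: A - hsnorm A *: B).
rewrite !(hsdotDl, hsdotDr, hsdotNl, hsdotNr, hsdotZl, hsdotZr) (hsdotC B A).
rewrite -!hsnorm_sqr => h.
rewrite -subr_ge0 -(pmulr_rge0 _ (mulr_gt0 A_gt0 B_gt0)).
nra.
Qed.

Lemma hsnorm_triangle m n (A B : 'M[R]_(m, n)) :
  hsnorm (A + B) <= hsnorm A + hsnorm B.
Proof.
rewrite -(@ler_pXn2r _ 2) ?nnegrE ?addr_ge0 ?hsnorm_ge0// hsnorm_sqr.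
rewrite hsdotDl !hsdotDr (hsdotC B A) -!hsnorm_sqr.
have := hsdot_le A B; nra.
Qed.

Lemma hsnorm_isom m n k (U : 'M[R]_(m, k)) (A : 'M[R]_(k, n)) :
  U^T *m U = 1%:M -> hsnorm (U *m A) = hsnorm A.
Proof. by move=> UU; apply: hsnorm_eq; rewrite hsdot_mull mulmxA UU mul1mx. Qed.

Lemma hsnorm_isomr m n k (U : 'M[R]_(n, k)) (A : 'M[R]_(m, n)) :
  U *m U^T = 1%:M -> hsnorm (A *m U) = hsnorm A.
Proof. by move=> UU; rewrite -hsnorm_tr trmx_mul hsnorm_isom ?trmxK ?hsnorm_tr. Qed.

(** With [z = M^T y], one has [|z|^2 = hsdot y (M z) <= |y| c |z|], and [|z|] cancels. *)
Lemma hsnorm_mul_le_tr m n k c (M : 'M[R]_(m, k)) :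
  0 <= c -> (forall x : 'M[R]_(k, n), hsnorm (M *m x) <= c * hsnorm x) ->
  forall y : 'M[R]_(m, n), hsnorm (M^T *m y) <= c * hsnorm y.
Proof.
move=> c_ge0 hM y; set z := M^T *m y.
have [->|/hsnorm_gt0 z_gt0] := eqVneq z 0.
  by rewrite hsnorm0 mulr_ge0 ?hsnorm_ge0.
rewrite -(ler_pM2r z_gt0) -expr2 hsnorm_sqr {1}/z hsdot_mull trmxK.
apply: le_trans (hsdot_le _ _) _; rewrite mulrAC mulrC.
by apply: ler_wpM2r; rewrite ?hsnorm_ge0.
Qed.

Lemma hsnorm_isom_tr m n k (U : 'M[R]_(m, k)) (A : 'M[R]_(m, n)) :
  U^T *m U = 1%:M -> hsnorm (U^T *m A) <= hsnorm A.
Proof.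
move=> UU; rewrite -[leRHS]mul1r; apply: hsnorm_mul_le_tr => // x.
by rewrite mul1r hsnorm_isom.
Qed.

Lemma hsdot_col m n (A : 'M[R]_(m, n)) :
  hsdot A A = \sum_(j < n) hsdot (col j A) (col j A).
Proof.
rewrite hsdotE exchange_big; apply: eq_bigr => j _; rewrite hsdotE.
by apply: eq_bigr => i _; rewrite big_ord1 !mxE.
Qed.

(** The squared Hilbert-Schmidt norm is the sum of the squared norms of the columns. This lemma
    carries operator-type bounds on vectors over to matrices. *)
Lemma hsnorm_cols_le m m' k n c (M : 'M[R]_(m, k)) (M' : 'M[R]_(m', k)) :
  0 <= c ->
  (forall x : 'cV[R]_k, hsnorm (M *m x) <= c * hsnorm (M' *m x)) ->
  forall W : 'M[R]_(k, n), hsnorm (M *m W) <= c * hsnorm (M' *m W).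
Proof.
move=> c_ge0 hM W; rewrite -hsnormZ// hsnorm_le hsdot_col [leRHS]hsdot_col.
apply: ler_sum => j _; rewrite -hsnorm_le linearZ/= hsnormZ//.
by rewrite !colE -!mulmxA -!colE.
Qed.

Lemma hsnorm_mul_le m k n c (M : 'M[R]_(m, k)) :
  0 <= c -> (forall x : 'cV[R]_k, hsnorm (M *m x) <= c * hsnorm x) ->
  forall W : 'M[R]_(k, n), hsnorm (M *m W) <= c * hsnorm W.
Proof.
move=> c_ge0 hM W; rewrite -[in leRHS](mul1mx W); apply: hsnorm_cols_le => // x.
by rewrite mul1mx.
Qed.

Lemma hsnorm_mulcV m k (M : 'M[R]_(m, k)) (x : 'cV[R]_k) :
  hsnorm (M *m x) <= hsnorm M * hsnorm x.
Proof.
rewrite -(@ler_pXn2r _ 2) ?nnegrE ?mulr_ge0 ?hsnorm_ge0// exprMn !hsnorm_sqr.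
rewrite hsdotE [hsdot M M]hsdotE mulr_suml; apply: ler_sum => i _.
have -> : \sum_(j < k) M i j * M i j = hsdot (row i M)^T (row i M)^T.
  by rewrite hsdot_tr hsdotE big_ord1; apply: eq_bigr => j _; rewrite !mxE.
have -> : \sum_(j < 1) (M *m x) i j * (M *m x) i j = hsdot (row i M)^T x ^+ 2.
  rewrite big_ord1 -expr2 hsdotE mxE; congr (_ ^+ 2).
  by apply: eq_bigr => j _; rewrite big_ord1 !mxE.
rewrite -!hsnorm_sqr -exprMn -real_normK ?num_real//.
rewrite lerXn2r ?nnegrE ?mulr_ge0 ?hsnorm_ge0// ler_norml hsdot_le andbT.
by rewrite -[leRHS]opprK lerN2 -hsdotNl -(hsnormN (row i M)^T) hsdot_le.
Qed.

(** The supremum in [opnorm] is a true one because [hsnorm M] bounds the set from above; the bound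
    is then read off at the normalized vector. *)
Lemma hsnorm_le_opnorm m n (M : 'M[R]_(m, n)) (x : 'cV[R]_n) :
  hsnorm (M *m x) <= opnorm M * hsnorm x.
Proof.
have [->|x_neq0] := eqVneq x 0; first by rewrite mulmx0 !hsnorm0 mulr0.
have x_gt0 := hsnorm_gt0 x_neq0.
rewrite -ler_pdivrMr// mulrC -hsnormZ ?invr_ge0 ?hsnorm_ge0// scalemxAr.
apply: ub_le_sup; last first.
  exists ((hsnorm x)^-1 *: x) => //=.
  by rewrite hsnormZ ?invr_ge0 ?hsnorm_ge0// mulVf ?gt_eqF.
exists (hsnorm M) => _ [y /= y_le1 <-]; apply: le_trans (hsnorm_mulcV _ _) _.
by rewrite ler_piMr ?hsnorm_ge0.
Qed.

Lemma opnorm_ge0 m n (M : 'M[R]_(m, n)) : 0 <= opnorm M.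
Proof.
apply: le_trans (hsnorm_ge0 (M *m 0)) _; apply: ub_le_sup.
  exists (hsnorm M) => _ [y /= y_le1 <-]; apply: le_trans (hsnorm_mulcV _ _) _.
  by rewrite ler_piMr ?hsnorm_ge0.
by exists 0 => //=; rewrite hsnorm0.
Qed.

End HilbertSchmidt.

(** * Symmetric forms and the polar decomposition *)

(* If the supremum [m] of the Rayleigh quotient were not an eigenvalue, the positive
   form [m - K] would be invertible, hence coercive, and [m] could be lowered. *)
Lemma sym_form_le (R : realType) n (K : 'M[R]_n) (b : R) :
  K^T = K ->
  (forall a (y : 'cV[R]_n), y != 0 -> K *m y = a *: y -> a <= b) ->
  forall x : 'cV[R]_n, hsdot x (K *m x) <= b * hsdot x x.
Proof.
move=> K_sym K_eig x0; rewrite leNgt; apply/negP => x0_big.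
pose S := [set t | exists2 x : 'cV[R]_n, x != 0 &
  hsdot x (K *m x) = t * hsdot x x]%classic.
have pos (x : 'cV[R]_n) : x != 0 -> 0 < hsdot x x.
  by move=> x_neq0; rewrite -hsnorm_sqr exprn_gt0 ?hsnorm_gt0.
have S_quot (x : 'cV[R]_n) : x != 0 -> S (hsdot x (K *m x) / hsdot x x).
  by move=> x_neq0; exists x => //; rewrite divfK ?gt_eqF ?pos.
have S_ub : ubound S (hsnorm K).
  move=> t [x x_neq0 tE]; rewrite -(ler_pM2r (pos _ x_neq0)) -tE.
  apply: le_trans (hsdot_le _ _) _; rewrite -hsnorm_sqr expr2 mulrA mulrC.
  by rewrite ler_wpM2r ?hsnorm_ge0// hsnorm_mulcV.
have x0_neq0 : x0 != 0.
  by apply: contraTN x0_big => /eqP->; rewrite /hsdot !mulmx0 mxtrace0 mulr0 ltxx.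
have S_sup : has_sup S.
  split; last by exists (hsnorm K).
  by exists (hsdot x0 (K *m x0) / hsdot x0 x0); apply: S_quot.
set m := sup S.
have m_ge (x : 'cV[R]_n) : hsdot x (K *m x) <= m * hsdot x x.
  have [->|x_neq0] := eqVneq x 0; first by rewrite /hsdot !mulmx0 mxtrace0 mulr0.
  by rewrite -ler_pdivrMr ?pos//; apply: ub_le_sup; [exists (hsnorm K)|apply: S_quot].
have b_lt_m : b < m.
  by rewrite -(ltr_pM2r (pos _ x0_neq0)); apply: lt_le_trans x0_big (m_ge _).
pose G := m%:M - K.
have G_sym : G^T = G by rewrite /G linearB/= tr_scalar_mx K_sym.
have G_unit : G \in unitmx.
  rewrite -row_free_unit -kermx_eq0; apply/eqP/row_matrixP => i; rewrite row0.
  apply/eqP/negPn/negP => v_neq0; set v := row i _ in v_neq0.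
  have vG : v *m G = 0 by apply/sub_kermxP; exact: row_sub.
  have : m <= b.
    apply: (K_eig _ v^T); first by rewrite trmx_eq0.
    rewrite -[in LHS]K_sym -trmx_mul -[RHS]linearZ/=; congr (_^T).
    by apply/eqP; rewrite eq_sym -subr_eq0 -mul_mx_scalar -mulmxBr vG.
  by rewrite leNgt b_lt_m.
have formG (x : 'cV[R]_n) : hsdot x (G *m x) = m * hsdot x x - hsdot x (K *m x).
  by rewrite mulmxBl mul_scalar_mx hsdotDr hsdotNr hsdotZr.
have G_ge0 (x : 'cV[R]_n) : 0 <= hsdot x (G *m x) by rewrite formG subr_ge0 m_ge.
(* The [+ 1] makes [L] positive without any look at the inverse. *)
pose L := hsnorm (invmx G) + 1.
have L_gt0 : 0 < L by rewrite ltr_wpDl ?hsnorm_ge0.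
have G_coercive (x : 'cV[R]_n) : hsdot x x / L <= hsdot x (G *m x).
  set y := invmx G *m x; have Gy : G *m y = x by rewrite mulKVmx.
  have xy : hsdot x y <= L * hsdot x x.
    apply: le_trans (hsdot_le _ _) _; rewrite -hsnorm_sqr expr2 mulrA mulrC.
    rewrite ler_wpM2r ?hsnorm_ge0//; apply: le_trans (hsnorm_mulcV _ _) _.
    by rewrite ler_wpM2r ?hsnorm_ge0// lerDl.
  (* As [G y = x], this form equals [hsdot x (G x) - 2 |x|^2 / L + hsdot x y / L^2], and the last
     term is at most [|x|^2 / L]. *)
  have := G_ge0 (x - L^-1 *: y).
  rewrite mulmxBr -scalemxAr Gy !(hsdotDl, hsdotDr, hsdotNl, hsdotNr, hsdotZl, hsdotZr).
  rewrite -[in hsdot y (G *m x)]G_sym -hsdot_mull Gy (hsdotC y x) => h.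
  have : L^-1 * (L^-1 * hsdot x y) <= L^-1 * hsdot x x.
    by rewrite ler_pM2l ?invr_gt0// -(ler_pM2l L_gt0) mulVKf ?gt_eqF.
  rewrite [_ / L]mulrC; lra.
have : m <= m - L^-1.
  apply: sup_le_ub; first by case: S_sup.
  move=> t [x x_neq0 tE]; rewrite -(ler_pM2r (pos _ x_neq0)) -tE mulrBl.
  have := G_coercive x; rewrite formG [_ / L]mulrC; lra.
by rewrite leNgt ltrBlDr ltrDl invr_gt0 L_gt0.
Qed.

(** Householder reflection in the hyperplane orthogonal to [v]; for [v = 0] it is the identity. *)
Definition hreflect (R : realType) n (v : 'cV[R]_n) : 'M[R]_n :=
  1%:M - (2 / hsdot v v) *: (v *m v^T).

Lemma hreflect_sym (R : realType) n (v : 'cV[R]_n) : (hreflect v)^T = hreflect v.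
Proof.
by rewrite /hreflect linearB/= linearZ/= trmx_mul trmxK trmx1.
Qed.

Lemma mulmx_cVtr (R : realType) n (v w : 'cV[R]_n) : v^T *m w = (hsdot v w)%:M.
Proof. by rewrite [LHS]mx11_scalar /hsdot trace_mx11. Qed.

Lemma hreflectK (R : realType) n (v : 'cV[R]_n) :
  v != 0 -> hreflect v *m hreflect v = 1%:M.
Proof.
move=> v_neq0; have v2 : hsdot v v != 0 by apply: contra v_neq0 => /eqP/hsdot_eq0->.
pose c := 2 / hsdot v v; pose P := v *m v^T.
have PP : P *m P = hsdot v v *: P.
  by rewrite mulmxA -(mulmxA v) mulmx_cVtr mul_mx_scalar -scalemxAl.
rewrite /hreflect -/c -/P mulmxBr mulmx1 mulmxBl mul1mx -scalemxAl -scalemxAr PP.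
rewrite !scalerA (_ : c * c * _ = c + c); last by rewrite /c; field.
by rewrite scalerDl opprB addrK subrK.
Qed.

(** The orthogonal group is compact and the trace form is continuous. Matrices are flattened to row
    vectors, for which the extreme value theorem is available. *)
Lemma orthogonal_trace_max (R : realType) n (W : 'M[R]_n) :
  exists2 Q : 'M[R]_n, Q^T *m Q = 1%:M &
    forall P : 'M[R]_n, P^T *m P = 1%:M -> hsdot P W <= hsdot Q W.
Proof.
pose A := [set v : 'rV[R]_(n * n) | (vec_mx v)^T *m vec_mx v = 1%:M]%classic.
have coord_cont i j : continuous (fun v : 'rV[R]_(n * n) => vec_mx v i j).
  move=> v; under eq_fun do rewrite mxE.
  exact: coord_continuous.
have A0 : (A !=set0)%classic.
  by exists (mxvec 1%:M); rewrite /A/= mxvecK trmx1 mulmx1.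
have A_closed : closed A.
  have -> : A = (\bigcap_(ij in [set: 'I_n * 'I_n])
    (fun v : 'rV[R]_(n * n) => \sum_k vec_mx v k ij.1 * vec_mx v k ij.2)
      @^-1` [set x | x = (ij.1 == ij.2)%:R])%classic.
    apply/seteqP; split=> v /=.
      move=> vA [i j] _ /=; have /matrixP/(_ i j) := vA; rewrite !mxE => <-.
      by apply: eq_bigr => k _; rewrite !mxE.
    move=> vA; apply/matrixP => i j; rewrite !mxE; have /= <- := vA (i, j) I.
    by apply: eq_bigr => k _; rewrite !mxE.
  apply: closed_bigI => ij _.
  set g := (X in closed (X @^-1` _)%classic).
  have : continuous g; last first.
    by move=> /continuous_closedP; apply; exact: closed_eq.
  apply: continuous_big => [|k _]; first exact: add_continuous.
  by move=> v; apply: continuousM; exact: coord_cont.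
have A_compact : compact A.
  have box_compact : compact
      [set v : 'rV[R]_(n * n) | forall i, `[(- 1 : R), 1]%classic (v ord0 i)]%classic.
    by apply: (@rV_compact R _ (fun=> `[- 1, 1]%classic)) => i; exact: segment_compact.
  (* The columns of an orthogonal matrix are unit vectors, so every entry lies in [[-1, 1]]. *)
  apply: subclosed_compact A_closed box_compact _ => v vA k /=.
  case/mxvec_indexP: k => i j; rewrite in_itv/= -ler_norml.
  have <- : vec_mx v i j = v ord0 (mxvec_index i j) by rewrite mxE.
  rewrite -(@ler_pXn2r _ 2) ?nnegrE// expr1n real_normK ?num_real//.
  have /matrixP/(_ j j) := vA; rewrite !mxE eqxx mulr1n => <-.
  rewrite (bigD1 i)//= !mxE -expr2 lerDl; apply: sumr_ge0 => l _.
  by rewrite !mxE -expr2 sqr_ge0.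
have f_cont : continuous (fun v : 'rV[R]_(n * n) => hsdot (vec_mx v) W).
  under eq_fun do rewrite hsdotE.
  apply: continuous_big => [|i _]; first exact: add_continuous.
  apply: continuous_big => [|j _]; first exact: add_continuous.
  by move=> v; apply: continuousM; [exact: coord_cont|exact: cst_continuous].
have [v /set_mem vA v_max] := EVT_max_rV A0 A_compact (continuous_subspaceT f_cont).
exists (vec_mx v) => // P PP; rewrite -(mxvecK P); apply: v_max.
by rewrite inE /A/= mxvecK.
Qed.

(** First-order optimality condition. For [A > 0] above [a], the value [t = b / A] would give
    [b^2 A <= b^2 a], which is false unless [b = 0]. *)
Lemma linear_le_quadratic (R : realFieldType) (a b : R) :
  (forall t, t * b <= t ^+ 2 * a) -> b = 0.
Proof.
move=> tab; apply/eqP/negPn/negP => b_neq0.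
pose A := `|a| + 1; have A_gt0 : 0 < A by rewrite ltr_wpDl.
have aA : a < A by rewrite /A; apply: le_lt_trans (ler_norm a) _; rewrite ltrDl.
have := tab (b / A); rewrite leNgt => /negP; apply.
have -> : (b / A) ^+ 2 * a = (b ^+ 2 / A ^+ 2) * a by rewrite expr_div_n.
have -> : b / A * b = (b ^+ 2 / A ^+ 2) * A.
  by field; rewrite gt_eqF.
by rewrite ltr_pM2l// divr_gt0// exprn_even_gt0//= ?orbT// gt_eqF.
Qed.

Lemma rank1_trace (R : realType) n (K : 'M[R]_n) (v w : 'cV[R]_n) :
  \tr (v *m w^T *m K) = hsdot w (K *m v).
Proof. by rewrite -mulmxA mxtrace_mulC /hsdot mulmxA. Qed.

(* Maximality of [tr (Q^T W)] is tested on [Q] times one reflection, which gives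
   positivity, and on [Q] times a product of two reflections, i.e. a rotation,
   which gives symmetry. *)
Lemma polar_decomposition (R : realType) n (W : 'M[R]_n) :
  exists Q : 'M[R]_n, [/\ Q^T *m Q = 1%:M, (Q^T *m W)^T = Q^T *m W &
    forall x : 'cV[R]_n, 0 <= hsdot x (Q^T *m W *m x)].
Proof.
have [Q QQ Qmax] := orthogonal_trace_max W.
set K := Q^T *m W; exists Q; rewrite -/K.
(* The competitor is [Q G^T], which is again orthogonal. *)
have trK (G : 'M[R]_n) : G *m G^T = 1%:M -> \tr (G *m K) <= \tr K.
  move=> GG; rewrite mulmxA -[G *m _]trmxK trmx_mul trmxK; apply: Qmax.
  by rewrite trmx_mul trmxK mulmxA -(mulmxA G) QQ mulmx1.
have pos (v : 'cV[R]_n) : v != 0 -> 0 < hsdot v v.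
  by move=> v0; rewrite -hsnorm_sqr exprn_gt0 ?hsnorm_gt0.
have psd (v : 'cV[R]_n) : 0 <= hsdot v (K *m v).
  have [->|v0] := eqVneq v 0; first by rewrite /hsdot !mulmx0 mxtrace0.
  have := trK (hreflect v); rewrite hreflect_sym hreflectK// => /(_ erefl).
  rewrite /hreflect mulmxBl mul1mx -scalemxAl linearB/= mxtraceZ rank1_trace.
  by rewrite gerBl pmulr_rge0// divr_gt0 ?pos.
split=> //.
(* Maximality against the product of two reflections, cleared of the factors [2 / hsdot v v] and
   [2 / hsdot w w]. *)
have rot (v w : 'cV[R]_n) : v != 0 -> w != 0 ->
    2 * (hsdot v w * hsdot w (K *m v)) <=
    hsdot w w * hsdot v (K *m v) + hsdot v v * hsdot w (K *m w).
  move=> v0 w0.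
  have /trK : hreflect v *m hreflect w *m (hreflect v *m hreflect w)^T = 1%:M.
    rewrite trmx_mul !hreflect_sym mulmxA -(mulmxA (hreflect v)) hreflectK//.
    by rewrite mulmx1 hreflectK.
  have v2 := pos v v0; have w2 := pos w w0.
  pose c (u : 'cV[R]_n) : R := 2 / hsdot u u.
  have -> : hreflect v *m hreflect w *m K = K - c w *: (w *m w^T *m K)
      - c v *: (v *m v^T *m K) + (c v * c w * hsdot v w) *: (v *m w^T *m K).
    have vw : v *m v^T *m (w *m w^T) = hsdot v w *: (v *m w^T).
      by rewrite mulmxA -(mulmxA v) mulmx_cVtr mul_mx_scalar -scalemxAl.
    rewrite {1}/hreflect mulmxBl mul1mx mulmxBl -/(c v) -!scalemxAl.
    rewrite /hreflect mulmxBr mulmx1 -scalemxAr vw -/(c w) !mulmxBl mul1mx.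
    by rewrite -!scalemxAl scalerBr !scalerA opprB addrA addrAC !mulrA.
  rewrite mxtraceD !linearB/= !mxtraceZ !rank1_trace.
  have cE u : 0 < hsdot u u -> c u * hsdot u u = 2.
    by move=> u2; rewrite divfK ?gt_eqF.
  move: (cE _ v2) (cE _ w2); set cv := c v; set cw := c w => cvE cwE h.
  have {}h : cv * cw * (2 * (hsdot v w * hsdot w (K *m v))) <=
      cv * cw * (hsdot w w * hsdot v (K *m v) + hsdot v v * hsdot w (K *m w)).
    have -> : cv * cw * (hsdot w w * hsdot v (K *m v) + hsdot v v * hsdot w (K *m w))
      = (cw * hsdot w w) * cv * hsdot v (K *m v) + (cv * hsdot v v) * cw * hsdot w (K *m w).
      by ring.
    rewrite cvE cwE; lra.
  by move: h; rewrite ler_pM2l// mulr_gt0// divr_gt0.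
have delta_form (A : 'M[R]_n) i j :
    hsdot (delta_mx i 0 : 'cV_n) (A *m delta_mx j 0) = A i j.
  rewrite -colE hsdotE (bigD1 i)//= big_ord1 !mxE !eqxx mul1r.
  by rewrite big1 ?addr0// => k /negPf ki; rewrite big_ord1 !mxE ki mul0r.
have delta_dot i j : hsdot (delta_mx i 0 : 'cV[R]_n) (delta_mx j 0) = (i == j)%:R.
  by rewrite -[delta_mx j 0]mul1mx delta_form mxE.
apply/matrixP => i j; rewrite mxE; have [->//|ij] := eqVneq i j.
apply/eqP; rewrite -subr_eq0; apply/eqP.
(* With [v = e_i] and [w = e_i + t e_j], [rot] becomes [t (K j i - K i j) <= t^2 (K i i + K j j)]
   for every [t]. *)
apply: (@linear_le_quadratic _ (K i i + K j j)) => t.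
have w2 : hsdot (delta_mx i 0 + t *: delta_mx j 0 : 'cV[R]_n)
    (delta_mx i 0 + t *: delta_mx j 0) = 1 + t ^+ 2.
  rewrite !(hsdotDl, hsdotDr, hsdotZl, hsdotZr) !delta_dot !eqxx (eq_sym j) (negPf ij).
  by rewrite !(mulr0, mulr1, addr0, add0r) expr2.
have := rot (delta_mx i 0) (delta_mx i 0 + t *: delta_mx j 0).
rewrite w2 mulmxDr -scalemxAr !(hsdotDl, hsdotDr, hsdotZl, hsdotZr) !delta_form.
rewrite !delta_dot eqxx (negPf ij).
have e_neq0 (v : 'cV[R]_n) : 0 < hsdot v v -> v != 0.
  by apply: contraTneq => ->; rewrite /hsdot mulmx0 mxtrace0 ltxx.
move=> h; have {}h := h (e_neq0 _ _) (e_neq0 _ _).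
rewrite delta_dot eqxx w2 in h.
have := h ltr01 (ltr_pwDl ltr01 (sqr_ge0 t)); rewrite !mulr1n !mulr0n; nra.
Qed.

(** * The Procrustes estimate *)

Lemma hsdot_gram (R : realType) m k l (A : 'M[R]_(m, k)) (B : 'M[R]_(m, l)) :
  hsdot (A *m A^T) (B *m B^T) = hsdot (A^T *m B) (A^T *m B).
Proof.
by rewrite /hsdot !trmx_mul !trmxK mulmxA mxtrace_mulC !mulmxA.
Qed.

Lemma hsdot_form_ge0 (R : realType) n k (K : 'M[R]_n) (A : 'M[R]_(n, k)) :
  (forall x : 'cV[R]_n, 0 <= hsdot x (K *m x)) -> 0 <= hsdot A (K *m A).
Proof.
move=> K_ge0.
have -> : hsdot A (K *m A) = \sum_(j < k) hsdot (col j A) (K *m col j A).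
  rewrite hsdotE exchange_big; apply: eq_bigr => j _.
  rewrite !colE mulmxA -!colE hsdotE.
  by apply: eq_bigr => i _; rewrite big_ord1 !mxE.
exact: sumr_ge0.
Qed.

(* With [S = U^T U], [P = X^T X] and [K = X^T U], the right-hand side is
   [tr S^2 + tr P^2 - 2 tr K^2], which equals [tr (D + a (K - P))^2 +
   (4 - 2a) tr (K D) + 2 (a - 1) tr (P D)] for [D = S - 2K + P] and [a = sqrt 2]. *)
Lemma procrustes_aligned (R : realType) m d (X U : 'M[R]_(m, d)) (c : R) :
  (X^T *m U)^T = X^T *m U ->
  (forall x : 'cV[R]_d, 0 <= hsdot x (X^T *m U *m x)) ->
  (forall x : 'cV[R]_d, c * hsdot x x <= hsdot (X *m x) (X *m x)) ->
  2 * (Num.sqrt 2 - 1) * c * hsdot (U - X) (U - X) <=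
  hsdot (U *m U^T - X *m X^T) (U *m U^T - X *m X^T).
Proof.
set K := X^T *m U => K_sym K_ge0 X_ge.
pose S := U^T *m U; pose P := X^T *m X; set D : 'M[R]_(m, d) := U - X.
have DE : D^T *m D = S - 2 *: K + P.
  have UX : U^T *m X = K by rewrite -K_sym trmx_mul trmxK.
  rewrite /D [(U - X)^T]linearB mulmxBr !mulmxBl UX -/K -/S -/P; clear.
  by apply/matrixP => i j; rewrite !mxE; ring.
have KD : 0 <= hsdot K (S - 2 *: K + P).
  by rewrite -DE -{2}[D]trmxK -hsdot_mulr hsdotC hsdot_form_ge0.
(* The form [P - c] is positive semidefinite by the lower bound on [X], so its trace against the
   Gram matrix [D^T D] is nonnegative. *)
have PD : c * hsdot D D <= hsdot P (S - 2 *: K + P).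
  rewrite -DE -{4}[D]trmxK -hsdot_mulr hsdotC -hsdot_tr -subr_ge0.
  rewrite -hsdotZr -hsdotNr -hsdotDr -mul_scalar_mx -mulNmx -mulmxDl.
  apply: hsdot_form_ge0 => x.
  rewrite mulmxBl mul_scalar_mx hsdotDr hsdotNr hsdotZr subr_ge0.
  by rewrite /P -mulmxA -{1}[X]trmxK -hsdot_mull trmxK.
clear DE; clearbody D.
have a2 : Num.sqrt 2 ^+ 2 = 2 :> R by rewrite sqr_sqrtr.
have a_ge1 : 1 <= Num.sqrt 2 :> R by rewrite -[leLHS]sqrtr1 ler_wsqrtr// ler1n.
have a_le2 : Num.sqrt 2 <= 2 :> R.
  by rewrite -(@ler_pXn2r _ 2) ?nnegrE ?sqrtr_ge0// a2; lra.
move: a2 a_ge1 a_le2 KD PD; set a := Num.sqrt 2 => a2 a_ge1 a_le2.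
(* This matrix is [(S - 2 K + P) + a (K - P)]; the final identity closes by [a^2 = 2]. *)
have := hsdot_ge0 (S + (a - 2) *: K + (1 - a) *: P).
rewrite !(hsdotDl, hsdotDr, hsdotNl, hsdotNr, hsdotZl, hsdotZr) !hsdot_gram.
rewrite -/S -/P -/K (_ : U^T *m X = K); last by rewrite -K_sym trmx_mul trmxK.
rewrite (hsdotC P S) (hsdotC K S) (hsdotC P K).
set SS := hsdot S S; set SP := hsdot S P; set SK := hsdot S K.
set KK := hsdot K K; set PP := hsdot P P; set KP := hsdot K P.
set DD := hsdot D D.
move=> E2 KD PD.
have h1 : 0 <= (4 - 2 * a) * (SK - 2 * KK + KP) by apply: mulr_ge0 => //; lra.
have h2 : 0 <= 2 * (a - 1) * (SP - 2 * KP + PP - c * DD) by apply: mulr_ge0; lra.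
rewrite -subr_ge0; apply: le_trans (addr_ge0 E2 (addr_ge0 h1 h2)) _.
by rewrite le_eqVlt; apply/orP; left; apply/eqP; ring: a2.
Qed.

(** Expanding in the overlaps of left and right singular vectors allows an entrywise comparison with
    the Gram matrix of the stacked factors. *)
Lemma hsdot_svd (R : realType) m n k l (U1 : 'M[R]_(m, k)) (V1 : 'M[R]_(n, k))
    (s1 : 'rV[R]_k) (U2 : 'M[R]_(m, l)) (V2 : 'M[R]_(n, l)) (s2 : 'rV[R]_l) :
  hsdot (U1 *m diag_mx s1 *m V1^T) (U2 *m diag_mx s2 *m V2^T) =
  \sum_i \sum_j s1 0 i * s2 0 j * ((U1^T *m U2) i j * (V1^T *m V2) i j).
Proof.
rewrite -mulmxA hsdot_mull hsdot_mulr trmxK !mulmxA -(mulmxA _ V2^T).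
have -> : V2^T *m V1 = (V1^T *m V2)^T by rewrite trmx_mul trmxK.
set A := U1^T *m U2; set B := V1^T *m V2.
rewrite hsdotE; apply: eq_bigr => i _; rewrite (bigD1 i)//= big1 => [|j ji].
  rewrite !mxE eqxx mulr1n addr0 mulr_sumr; apply: eq_bigr => j _.
  by rewrite mul_mx_diag !mxE; ring.
by rewrite mxE eq_sym (negPf ji) mul0r.
Qed.

Lemma diag_sqrtK (R : realType) d (s : 'rV[R]_d) : (forall i, 0 <= s 0 i) ->
  diag_mx (map_mx Num.sqrt s) *m diag_mx (map_mx Num.sqrt s) = diag_mx s.
Proof.
move=> s_ge0; rewrite mulmx_diag; congr diag_mx; apply/rowP => i.
by rewrite !mxE -expr2 sqr_sqrtr.
Qed.

Lemma diag_form_ge (R : realType) d k (s : 'rV[R]_d) (c : R) (A : 'M[R]_(d, k)) :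
  (forall i, c <= s 0 i) -> c * hsdot A A <= hsdot A (diag_mx s *m A).
Proof.
move=> s_ge; rewrite !hsdotE mulr_sumr; apply: ler_sum => i _.
rewrite mulr_sumr; apply: ler_sum => j _.
by rewrite mul_diag_mx !mxE [leRHS]mulrCA ler_wpM2r// -expr2 sqr_ge0.
Qed.

Lemma procrustes_svd (R : realType) m n d (U1 U2 : 'M[R]_(m, d))
    (V1 V2 : 'M[R]_(n, d)) (s1 s2 : 'rV[R]_d) (c : R) :
  U1^T *m U1 = 1%:M -> V1^T *m V1 = 1%:M ->
  U2^T *m U2 = 1%:M -> V2^T *m V2 = 1%:M ->
  (forall i, 0 <= s1 0 i) -> (forall i, 0 <= s2 0 i) -> (forall i, c <= s1 0 i) ->
  let E := U2 *m diag_mx s2 *m V2^T - U1 *m diag_mx s1 *m V1^T in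
  exists2 Q : 'M[R]_d, Q^T *m Q = 1%:M &
    (Num.sqrt 2 - 1) * c *
      (hsnorm (obs_factor U2 s2 - obs_factor U1 s1 *m Q) ^+ 2 +
       hsnorm (ctrl_factor s2 V2 - Q^T *m ctrl_factor s1 V1) ^+ 2) <=
    hsnorm E ^+ 2.
Proof.
move=> UU1 VV1 UU2 VV2 s1_ge0 s2_ge0 s1_ge E.
pose g (s : 'rV[R]_d) : 'M[R]_d := diag_mx (map_mx Num.sqrt s).
pose Z (U : 'M[R]_(m, d)) (s : 'rV[R]_d) (V : 'M[R]_(n, d)) :=
  col_mx (obs_factor U s) (ctrl_factor s V)^T.
have ZZ (U : 'M[R]_(m, d)) (s : 'rV[R]_d) (V : 'M[R]_(n, d)) U' s' V' :
    (Z U s V)^T *m Z U' s' V' =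
    g s *m (U^T *m U' + V^T *m V') *m g s'.
  rewrite /Z tr_col_mx mul_row_col trmxK /obs_factor /ctrl_factor !trmx_mul.
  by rewrite trmxK !tr_diag_mx -/(g s) -/(g s') mulmxDr mulmxDl !mulmxA.
have gg (s : 'rV[R]_d) : (forall i, 0 <= s 0 i) ->
    g s *m (1%:M + 1%:M) *m g s = 2 *: diag_mx s.
  move=> s_ge0; rewrite mulmxDr mulmx1 mulmxDl diag_sqrtK//.
  by rewrite scaler_nat mulr2n.
have ZZ1 : (Z U1 s1 V1)^T *m Z U1 s1 V1 = 2 *: diag_mx s1 by rewrite ZZ UU1 VV1 gg.
have ZZ2 : (Z U2 s2 V2)^T *m Z U2 s2 V2 = 2 *: diag_mx s2 by rewrite ZZ UU2 VV2 gg.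
have ZZ12 := ZZ U1 s1 V1 U2 s2 V2.
move: ZZ1 ZZ2 ZZ12; set Z1 := Z U1 s1 V1; set Z2 := Z U2 s2 V2 => ZZ1 ZZ2 ZZ12.
have [Q [QQ QW_sym QW_ge0]] := polar_decomposition (Z1^T *m Z2).
have QQ' := mulmx1C QQ.
exists Q => //.
(* The factor 2 in [2 * c] comes from the Gram matrix [2 *: diag_mx s1] of [Z1]. *)
have := @procrustes_aligned _ _ _ (Z1 *m Q) Z2 (2 * c).
have -> : (Z1 *m Q)^T *m Z2 = Q^T *m (Z1^T *m Z2) by rewrite trmx_mul mulmxA.
move=> /(_ QW_sym QW_ge0); rewrite [(Z1 *m Q)^T]trmx_mul.
have -> : hsdot (Z2 - Z1 *m Q) (Z2 - Z1 *m Q) =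
    hsnorm (obs_factor U2 s2 - obs_factor U1 s1 *m Q) ^+ 2 +
    hsnorm (ctrl_factor s2 V2 - Q^T *m ctrl_factor s1 V1) ^+ 2.
  rewrite -(hsnorm_tr (ctrl_factor s2 V2 - _)) linearB/= [(Q^T *m _)^T]trmx_mul trmxK.
  rewrite !hsnorm_sqr.
  rewrite /Z1 /Z2 /Z mul_col_mx opp_col_mx add_col_mx.
  by rewrite /hsdot tr_col_mx mul_row_col mxtraceD.
have -> : Z1 *m Q *m (Q^T *m Z1^T) = Z1 *m Z1^T.
  by rewrite mulmxA -(mulmxA Z1) QQ' mulmx1.
have Z_ge (x : 'cV[R]_d) : 2 * c * hsdot x x <= hsdot (Z1 *m Q *m x) (Z1 *m Q *m x).
  rewrite -!mulmxA hsdot_mull !mulmxA ZZ1 -!scalemxAl hsdotZr -mulrA.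
  rewrite ler_pM2l// -mulmxA (_ : hsdot x x = hsdot (Q *m x) (Q *m x)).
    exact: diag_form_ge.
  by rewrite hsdot_mull mulmxA QQ mul1mx.
move=> /(_ Z_ge) h.
suff : hsdot (Z2 *m Z2^T - Z1 *m Z1^T) (Z2 *m Z2^T - Z1 *m Z1^T) <= 4 * hsnorm E ^+ 2.
  move=> /(le_trans h); lra.
pose S (s : 'rV[R]_d) := hsdot (diag_mx s) (diag_mx s).
have S_E (U : 'M[R]_(m, d)) (V : 'M[R]_(n, d)) s : U^T *m U = 1%:M ->
    V^T *m V = 1%:M -> hsdot (U *m diag_mx s *m V^T) (U *m diag_mx s *m V^T) = S s.
  by move=> UU VV; rewrite -hsnorm_sqr hsnorm_isomr ?trmxK// hsnorm_isom// hsnorm_sqr.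
have EE : hsnorm E ^+ 2 = S s2 + S s1 -
    2 * hsdot (U1 *m diag_mx s1 *m V1^T) (U2 *m diag_mx s2 *m V2^T).
  rewrite hsnorm_sqr !(hsdotDl, hsdotDr, hsdotNl, hsdotNr) opprK !S_E//.
  rewrite (hsdotC (U2 *m _ *m _) (U1 *m _ *m _)); ring.
rewrite EE !(hsdotDl, hsdotDr, hsdotNl, hsdotNr) opprK (hsdotC (Z2 *m Z2^T) (Z1 *m Z1^T)).
rewrite !hsdot_gram ZZ1 ZZ2 ZZ12 !(hsdotZl, hsdotZr) -/(S s1) -/(S s2) hsdot_svd.
set X := \sum_i _; set Y := hsdot _ _.
(* The pure terms [4 S s1] and [4 S s2] agree on both sides. The cross terms compare entrywise by
   [4 a b <= (a + b)^2], where [a] and [b] are the two overlaps. *)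
suff : 4 * X <= Y by lra.
rewrite /X /Y hsdotE mulr_sumr; apply: ler_sum => i _.
rewrite mulr_sumr; apply: ler_sum => j _.
rewrite mul_mx_diag mul_diag_mx !mxE.
set a := \sum_k _; set b := \sum_k _.
rewrite -expr2 !exprMn !sqr_sqrtr//.
have : 0 <= s1 0 i * s2 0 j * (a - b) ^+ 2.
  by rewrite mulr_ge0 ?sqr_ge0// mulr_ge0 ?s1_ge0 ?s2_ge0.
lra.
Qed.

(** * Singular values *)

(** Sylvester's identity: the block [b] of [M] is eliminated once by column and once by row
    operations, and the two values of [\det M] are compared. *)
Lemma char_poly_mulC (R : comNzRingType) m n (A : 'M[R]_(m, n)) (B : 'M[R]_(n, m)) :
  'X^n * char_poly (A *m B) = 'X^m * char_poly (B *m A).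
Proof.
pose a := map_mx (@polyC R) A; pose b := map_mx (@polyC R) B.
pose M : 'M[{poly R}]_(m + n) := block_mx 'X%:M a b 1%:M.
have M_AB : \det M = char_poly (A *m B).
  have : M *m block_mx 1%:M 0 (- b) 1%:M = block_mx (char_poly_mx (A *m B)) a 0 1%:M.
    rewrite mulmx_block !mulmx1 !mulmx0 !add0r mul1mx subrr mulmxN.
    by rewrite /char_poly_mx map_mxM.
  by move=> /(congr1 determinant); rewrite det_mulmx det_lblock det_ublock !det1 !mulr1.
have : block_mx 1%:M 0 (- b) 'X%:M *m M = block_mx 'X%:M a 0 (char_poly_mx (B *m A)).
  rewrite mulmx_block !mul1mx !mul0mx !addr0 mulNmx mulmx1.
  rewrite mul_scalar_mx mul_mx_scalar addrC subrr mulNmx addrC.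
  by rewrite /char_poly_mx map_mxM.
move=> /(congr1 determinant); rewrite det_mulmx det_lblock det_ublock.
by rewrite !det_scalar expr1n mul1r M_AB.
Qed.

Section SingularValueList.
Variable R : realType.

Definition root_list (p : {poly R}) : seq R :=
  flatten [seq nseq (mup x p) x | x <- rev (rootsR p)].

Lemma singular_valuesE m n (M : 'M[R]_(m, n)) :
  singular_values M = map Num.sqrt (root_list (char_poly (M^T *m M))).
Proof.
rewrite /singular_values /root_list map_flatten -map_comp; congr flatten.
by apply: eq_map => x /=; rewrite map_nseq.
Qed.

Lemma count_root_list p y : p != 0 -> count_mem y (root_list p) = mup y p.
Proof.
move=> p_neq0; have : uniq (rev (rootsR p)).
  by rewrite rev_uniq (sorted_uniq lt_trans ltxx)// sorted_roots.
have : (y \notin rev (rootsR p)) -> mup y p = 0%N.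
  by rewrite mem_rev -roots_on_rootsR// => ?; rewrite mupNroot.
rewrite /root_list; elim: (rev _) => /= [->//|x r IHr] h /andP[xr r_uniq].
rewrite count_cat count_nseq/= [x == y]eq_sym.
have [yx|yx] := eqVneq y x.
  suff -> : count_mem y (flatten [seq nseq (mup x p) x | x <- r]) = 0%N.
    by rewrite mul1n addn0 yx.
  apply/count_memPn/flatten_mapP => -[z zr]; rewrite mem_nseq => /andP[_ /eqP yz].
  by move: xr; rewrite -yx yz zr.
by rewrite mul0n IHr// => yr; apply: h; rewrite inE negb_or yx.
Qed.

Lemma mem_root_list p x : p != 0 -> (x \in root_list p) = root p x.
Proof.
by move=> p0; rewrite -has_pred1 has_count count_root_list// -XsubC_dvd// dvdp_XsubCl.
Qed.

Lemma root_list_sorted p : sorted >=%R (root_list p).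
Proof.
have : pairwise >%R (rev (rootsR p)).
  by rewrite -sorted_pairwise ?rev_sorted ?sorted_roots// => x y z xy /lt_trans; apply.
rewrite sorted_pairwise => [|x y z xy /le_trans]; last by apply.
rewrite /root_list; elim: (rev _) => //= x r IHr /andP[/allP xr r_sorted].
rewrite pairwise_cat IHr// andbT; apply/andP; split; last first.
  by elim: (mup x p) => //= k ->; rewrite andbT all_nseq /= lexx orbT.
apply/allrelP => y z; rewrite mem_nseq => /andP[_ /eqP->] /flatten_mapP[t tr].
by rewrite mem_nseq => /andP[_ /eqP->]; apply: ltW; exact: xr.
Qed.

(** Dividing out the full power of ['X - x%:P] lowers the degree by the multiplicity of [x] and
    leaves the other multiplicities unchanged. *)
Lemma sum_mup_le (r : seq R) p : uniq r -> p != 0 ->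
  (\sum_(x <- r) mup x p <= (size p).-1)%N.
Proof.
elim: r p => [|x r IHr] p; first by rewrite big_nil.
move=> /= /andP[xr r_uniq] p_neq0; rewrite big_cons.
have : ('X - x%:P) ^+ mup x p %| p by rewrite -mup_geq.
move: (mup x p) => k /dvdpP[q pE].
have q_neq0 : q != 0 by apply: contra p_neq0 => /eqP q0; rewrite pE q0 mul0r.
rewrite [in leqRHS]pE size_mul ?expf_neq0 ?polyXsubC_eq0// size_exp_XsubC addnS/= addnC.
rewrite -subn1 -addnBAC ?size_poly_gt0// subn1 leq_add2r.
apply: leq_trans (IHr _ r_uniq q_neq0); rewrite leq_eqVlt; apply/orP; left.
apply/eqP; apply: eq_big_seq => y yr; rewrite pE mupMl//
  /root horner_exp hornerXsubC expf_eq0 subr_eq0 negb_and.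
by apply/orP; right; apply: contraNneq xr => <-.
Qed.

Lemma size_root_list p : p != 0 -> (size (root_list p) <= (size p).-1)%N.
Proof.
move=> p_neq0; rewrite /root_list size_flatten /shape -map_comp sumnE big_map.
under eq_bigr do rewrite /= size_nseq.
by apply: sum_mup_le => //; rewrite rev_uniq (sorted_uniq lt_trans ltxx)// sorted_roots.
Qed.

(** Both lists are nonincreasing and contain every value equally often, hence they coincide. *)
Lemma root_list_prod l : sorted >=%R l ->
  root_list (\prod_(x <- l) ('X - x%:P)) = l.
Proof.
move=> l_sorted; set p := \prod_(_ <- _) _.
have p_neq0 : p != 0 by rewrite monic_neq0 ?monic_prod_XsubC.
apply: (@sorted_eq _ >=%R) => //.
- by move=> x y z xy /le_trans; apply.
- by move=> x y; rewrite andbC => /le_anti.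
- exact: root_list_sorted.
apply/allP => x _ /=.
by rewrite count_root_list// mu_prod_XsubC.
Qed.

Lemma singular_values_sorted m n (M : 'M[R]_(m, n)) : sorted >=%R (singular_values M).
Proof.
rewrite singular_valuesE; apply: homo_sorted (root_list_sorted _) => x y.
exact: ler_wsqrtr.
Qed.

Lemma singular_value_ge0 m n k (M : 'M[R]_(m, n)) : 0 <= singular_value k M.
Proof.
rewrite /singular_value singular_valuesE; set l := root_list _.
have [kl|kl] := ltnP k.-1 (size l); last by rewrite nth_default ?size_map.
by rewrite (nth_map 0)// sqrtr_ge0.
Qed.

Lemma singular_value_last_le m n (M : 'M[R]_(m, n)) x :
  x \in singular_values M -> singular_value n M <= x.
Proof.
move=> /[dup] x_in /(nthP 0)[i i_lt <-]; rewrite /singular_value.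
have size_le : (size (singular_values M) <= n)%N.
  rewrite singular_valuesE size_map -[n in leqRHS]/(n.+1.-1) -(size_char_poly (M^T *m M)).
  by rewrite size_root_list// monic_neq0 ?char_poly_monic.
(* Only the upper bound [n] on the length has been established. For a shorter list, [nth] returns
   its default [0], still a lower bound for nonnegative values. *)
have [n_lt|n_ge] := ltnP n.-1 (size (singular_values M)).
  apply: (sorted_leq_nth _ _ _ (singular_values_sorted M)) => //.
  - by move=> u v w uv /le_trans; apply.
  - by move=> u; exact: lexx.
  - have := leq_trans i_lt size_le; clear; case: n => //.
rewrite nth_default//; move: i_lt; rewrite singular_valuesE size_map => i_lt.
by rewrite (nth_map 0)// sqrtr_ge0.
Qed.

(* The left-hand side is the smallest singular value, as [M] has [n] columns. *)
Lemma singular_value_coercive m n (M : 'M[R]_(m, n)) (x : 'cV[R]_n) :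
  singular_value n M * hsnorm x <= hsnorm (M *m x).
Proof.
have chi_neq0 : char_poly (M^T *m M) != 0 by rewrite monic_neq0 ?char_poly_monic.
have s_ge0 := singular_value_ge0 n M; set s := singular_value n M in s_ge0 *.
(* [sym_form_le] bounds forms from above, so it is applied to [- M^T M], whose eigenvalues are at
   most [- s^2]. *)
have : hsdot x (- (M^T *m M) *m x) <= - s ^+ 2 * hsdot x x.
  apply: sym_form_le => [|a y y_neq0]; first by rewrite linearN/= trmx_mul trmxK.
  rewrite mulNmx => /(canRL opprK) yE.
  have a_root : root (char_poly (M^T *m M)) (- a).
    rewrite -eigenvalue_root_char; apply/eigenvalueP; exists y^T;
      last by rewrite trmx_eq0.
    have MM_sym : (M^T *m M)^T = M^T *m M by rewrite trmx_mul trmxK.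
    rewrite -MM_sym -trmx_mul yE scaleNr.
    by rewrite linearN linearZ.
  have a_le0 : 0 <= - a.
    have y_gt0 : 0 < hsdot y y by rewrite -hsnorm_sqr exprn_gt0 ?hsnorm_gt0.
    rewrite -(pmulr_lge0 _ y_gt0) mulNr -hsdotZr -hsdotNr -yE -mulmxA.
    by rewrite -hsdot_mull hsdot_ge0.
  rewrite lerNr -[leRHS]sqr_sqrtr// ler_sqr ?nnegrE ?sqrtr_ge0//.
  by apply: singular_value_last_le; rewrite singular_valuesE;
    apply: map_f; rewrite mem_root_list.
rewrite mulNmx hsdotNr mulNr lerN2 -mulmxA -hsdot_mull.
rewrite -!hsnorm_sqr -exprMn ler_sqr ?nnegrE ?mulr_ge0 ?hsnorm_ge0//.
Qed.

End SingularValueList.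

(** [char_poly_mulC] moves [V] to the other end, where [V^T V = 1] leaves the diagonal matrix of
    squares. The change of size from [n] to [q] accounts for the [n - q] zero roots. *)
Lemma svd_char_poly (R : realType) m n q (M : 'M[R]_(m, n)) U s V : is_svd M U s V ->
  (q <= n)%N /\ char_poly (M^T *m M) =
  \prod_(x <- [seq s 0 i ^+ 2 | i <- enum 'I_q] ++ nseq (n - q) 0) ('X - x%:P).
Proof.
case=> UU VV s_ge0 s_sorted ->.
have qn : (q <= n)%N.
  rewrite -(@mxrank1 R q) -VV; apply: leq_trans (mxrankM_maxl _ _) (rank_leq_col _).
split=> //.
have -> : (U *m diag_mx s *m V^T)^T *m (U *m diag_mx s *m V^T) =
    V *m (diag_mx s *m diag_mx s *m V^T).
  rewrite !trmx_mul trmxK tr_diag_mx !mulmxA; congr (_ *m _ *m _).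
  by rewrite -!mulmxA UU mulmx1.
have Xq_neq0 : 'X^q != 0 :> {poly R} by rewrite monic_neq0 ?monicXn.
apply: (mulfI Xq_neq0); rewrite char_poly_mulC -!mulmxA VV mulmx1.
rewrite -{1}(subnKC qn) exprD -mulrA; congr (_ * _).
rewrite mulmx_diag char_poly_trig ?diag_mx_is_trig// big_cat/= mulrC; congr (_ * _).
  rewrite big_map big_enum/=; apply: eq_bigr => i _.
  by rewrite !mxE eqxx mulr1n expr2.
by rewrite big_nseq subr0 iter_mulr_1.
Qed.

Lemma svd_singular_values (R : realType) m n q (M : 'M[R]_(m, n)) U (s : 'rV_q) V :
  is_svd M U s V ->
  singular_values M = [seq s 0 i | i <- enum 'I_q] ++ nseq (n - q) 0.
Proof.
move=> M_svd; have [qn] := svd_char_poly M_svd.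
rewrite singular_valuesE => ->; case: M_svd => _ _ s_ge0 s_sorted _.
rewrite root_list_prod.
  rewrite map_cat -map_comp map_nseq sqrtr0; congr (_ ++ _).
  by apply: eq_map => i /=; rewrite sqrtr_sqr ger0_norm.
rewrite sorted_pairwise => [|x y z xy /le_trans]; last by apply.
rewrite pairwise_cat; apply/and3P; split.
- apply/allrelP => x y /mapP[i _ ->]; rewrite mem_nseq => /andP[_ /eqP->].
  exact: sqr_ge0.
- rewrite pairwise_map; apply: (@sub_pairwise _ (relpre val leq)) => [i j ij /=|].
    by rewrite ler_sqr ?nnegrE ?s_ge0// s_sorted.
  by rewrite -pairwise_map val_enum_ord -sorted_pairwise ?iota_sorted//; exact: leq_trans.
by elim: (n - q)%N => //= k ->; rewrite andbT all_nseq /= lexx orbT.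
Qed.

Lemma svd_singular_value (R : realType) m n q (M : 'M[R]_(m, n)) U (s : 'rV_q) V
    (i : 'I_q) :
  is_svd M U s V -> singular_value i.+1 M = s 0 i.
Proof.
move=> /svd_singular_values; rewrite /singular_value => ->.
rewrite nth_cat size_map size_enum_ord ltn_ord (nth_map i) ?size_enum_ord//.
  by rewrite nth_ord_enum.
exact: ltn_ord.
Qed.

(** * Submatrices, Hankel factorization and pseudo-inverses *)

Section Submatrices.
Variable R : realType.

Lemma subrows_mul m n k a m' (M : 'M[R]_(m, k)) (N : 'M[R]_(k, n)) :
  subrows a m' (M *m N) = subrows a m' M *m N.
Proof.
apply/matrixP => i j; rewrite !mxE; under [RHS]eq_bigr do rewrite mxE.
case: insub => [i'|]; first by rewrite mxE.
by rewrite big1 // => l _; rewrite mul0r.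
Qed.

Lemma subrowsB m n a m' (M N : 'M[R]_(m, n)) :
  subrows a m' (M - N) = subrows a m' M - subrows a m' N.
Proof.
by apply/matrixP => i j; rewrite !mxE; case: insub => [i'|]; rewrite ?mxE ?subr0.
Qed.

(** Each row of [M] is picked at most once, by [i = k - a], and the padding rows contribute
    nothing. *)
Lemma hsnorm_subrows m n a m' (M : 'M[R]_(m, n)) :
  hsnorm (subrows a m' M) <= hsnorm M.
Proof.
rewrite hsnorm_le !hsdotE; set g := fun k : 'I_m => \sum_j M k j * M k j.
have g_ge0 k : 0 <= g k by apply: sumr_ge0 => j _; rewrite -expr2 sqr_ge0.
apply: (@le_trans _ _ (\sum_(i < m') \sum_(k < m | (k == a + i :> nat)%N) g k)).
  apply: ler_sum => i _; under eq_bigr do rewrite mxE.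
  case: insubP => [k _ kE|_]; last by rewrite big1 ?sumr_ge0// => j _; rewrite mul0r.
  by rewrite (big_pred1 k)// => l; rewrite /= -kE.
rewrite (exchange_big_dep predT)//=; apply: ler_sum => k _.
have [k_in|k_out] := boolP ((a <= k) && (k - a < m'))%N.
  case/andP: k_in => ak km; rewrite (big_pred1 (Ordinal km))// => i /=.
  by rewrite -(inj_eq val_inj)/= -(eqn_add2l a i) subnKC// eq_sym.
rewrite big_pred0 => [|i]; first exact: g_ge0.
apply/negbTE; apply: contra k_out => /eqP->.
by rewrite leq_addr addKn ltn_ord.
Qed.

Lemma realize_B_sub r T q (C D : 'M[R]_(q, T * r)) :
  realize_B C - realize_B D = subcols 0 r (C - D).
Proof. by rewrite /realize_B /subcols -linearB -subrowsB -linearB. Qed.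

Lemma realize_B_mul r T q k (P : 'M[R]_(k, q)) (C : 'M[R]_(q, T * r)) :
  P *m realize_B C = realize_B (P *m C).
Proof.
by rewrite /realize_B /subcols trmx_mul subrows_mul trmx_mul trmxK.
Qed.

Lemma hsnorm_subcols m n a n' (M : 'M[R]_(m, n)) : hsnorm (subcols a n' M) <= hsnorm M.
Proof. by rewrite /subcols hsnorm_tr -[leRHS]hsnorm_tr hsnorm_subrows. Qed.

End Submatrices.

Definition observability (R : realType) d p (T : nat) (A : 'M[R]_d) (C : 'M[R]_(p, d)) :
    'M[R]_(T * p, d) :=
  castmx (sum_ord_const T p, erefl) (\mxcol_(i < T) (C *m A ^+ i)).

Definition controllability (R : realType) d r (T : nat) (A : 'M[R]_d) (B : 'M[R]_(d, r)) :
    'M[R]_(d, T * r) :=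
  castmx (erefl, sum_ord_const T r) (\mxrow_(j < T) (A ^+ j *m B)).

Lemma castmx_mulmx (R : realType) m m' n n' k (em : m = m') (en : n = n')
    (M : 'M[R]_(m, k)) (N : 'M[R]_(k, n)) :
  castmx (em, en) (M *m N) = castmx (em, erefl) M *m castmx (erefl, en) N.
Proof. by case: m' / em; case: n' / en; rewrite !castmx_id. Qed.

Lemma block_hankel_factor (R : realType) d r p (T : nat) (A : 'M[R]_d)
    (B : 'M[R]_(d, r)) (C : 'M[R]_(p, d)) :
  block_hankel T A B C = observability T A C *m controllability T A B.
Proof.
rewrite /block_hankel -castmx_mulmx mul_mxcol_mxrow; congr castmx.
by apply: eq_mxblock => i j; rewrite /markov -mulmxA mulmxA exprD mulmxA !mulmxA.
Qed.

Lemma observabilityE (R : realType) d p (T : nat) (A : 'M[R]_d) (C : 'M[R]_(p, d))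
    (k : 'I_(T * p)) (i : 'I_T) (l : 'I_p) j :
  k = (i * p + l)%N :> nat -> observability T A C k j = (C *m A ^+ i) l j.
Proof.
move=> kE; rewrite castmxE cast_ord_id -[C *m _](mxcolK (fun i : 'I_T => C *m A ^+ i)).
rewrite [RHS]mxE; congr (fun_of_matrix _ _ _); apply: ord_inj.
(* The rank of a tagged index is its offset plus the sizes of the preceding blocks, here [i * p]. *)
rewrite tagnat.RankEsum [LHS]kE; congr (_ + _)%N.
by rewrite -(big_ord_widen _ (fun=> p)) ?sum_ord_const// ltnW.
Qed.

(** Moving down by one block of [p] rows passes from [C A^i] to [C A^(i+1) = (C A^i) A]. *)
Lemma observability_shift (R : realType) d p (T : nat) (A : 'M[R]_d) (C : 'M[R]_(p, d)) :
  subrows p (T.-1 * p) (observability T A C) =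
  subrows 0 (T.-1 * p) (observability T A C) *m A.
Proof.
apply/matrixP => k j; have := ltn_ord k; rewrite -ltn_divLR; last first.
  (* For [p = 0] there is no row index [k]. *)
  by case: p k {C} => // -[k]; rewrite muln0.
move=> k_lt; have p_gt0 : (0 < p)%N by case: p k {C k_lt} => // -[k]; rewrite muln0.
have l_lt : (k %% p < p)%N by rewrite ltn_mod.
have i_lt : (k %/ p < T)%N by apply: leq_trans k_lt (leq_pred _).
have i1_lt : ((k %/ p).+1 < T)%N by move: k_lt; move: (k %/ p)%N; clear; case: T.
have T_gt0 : (0 < T)%N by apply: leq_ltn_trans i1_lt.

have kT : (p + k < T * p)%N.
  by rewrite -[T in (_ < T * p)%N](prednK T_gt0) mulSn ltn_add2l.
have kT0 : (0 + k < T * p)%N by apply: leq_ltn_trans kT; rewrite leq_add2r.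
rewrite !mxE; under eq_bigr do rewrite mxE.
rewrite !insubT/=.
rewrite (@observabilityE _ _ _ _ _ _ _ (Ordinal i1_lt) (Ordinal l_lt)) /=; last first.
  by rewrite mulSn -addnA -divn_eq.
under eq_bigr do
  rewrite (@observabilityE _ _ _ _ _ _ _ (Ordinal i_lt) (Ordinal l_lt)) /= -?divn_eq//.
by rewrite exprSr mulmxA mxE.
Qed.

Section PseudoInverse.
Variable R : realType.

(** [M X] and [M Y] are orthogonal projectors with the same range, hence equal; likewise
    [X M = Y M]. Then [X = X M X = X M Y = Y M Y = Y]. *)
Lemma pseudo_inverse_unique m n (M : 'M[R]_(m, n)) X Y :
  is_pseudo_inverse M X -> is_pseudo_inverse M Y -> X = Y.
Proof.
case=> MXM XMX MX XM [MYM YMY MY YM].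
have MXY : M *m X = M *m Y.
  have e1 : M *m X *m (M *m Y) = M *m Y by rewrite mulmxA MXM.
  have e2 : M *m Y *m (M *m X) = M *m X by rewrite mulmxA MYM.
  by rewrite -e2 -MX -MY -trmx_mul e1.
have XMY : X *m M = Y *m M.
  have e1 : X *m M *m (Y *m M) = X *m M by rewrite -mulmxA (mulmxA M) MYM.
  have e2 : Y *m M *m (X *m M) = Y *m M by rewrite -mulmxA (mulmxA M) MXM.
  by rewrite -e1 -XM -YM -trmx_mul e2.
by rewrite -XMX -mulmxA MXY mulmxA XMY YMY.
Qed.

(** [X] solves the Penrose equations for [M] exactly when [Q^T X] solves them for [M Q]. The
    degenerate case [sO = 0] offers no coercivity, so the default [0] of [xget] is carried along as
    well. *)
Lemma pseudo_inverse_mulr m n (M : 'M[R]_(m, n)) (Q : 'M[R]_n) : Q^T *m Q = 1%:M ->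
  pseudo_inverse (M *m Q) = Q^T *m pseudo_inverse M.
Proof.
move=> QQ; have QQ' := mulmx1C QQ.
have pinv_mul (N : 'M[R]_(m, n)) (P : 'M[R]_n) X : P^T *m P = 1%:M ->
    is_pseudo_inverse N X -> is_pseudo_inverse (N *m P) (P^T *m X).
  move=> PP [NXN XNX NX XN]; have PP' := mulmx1C PP.
  have NPX : N *m P *m (P^T *m X) = N *m X by rewrite mulmxA -(mulmxA N) PP' mulmx1.
  split.
  - by rewrite NPX mulmxA NXN.
  - by rewrite -mulmxA NPX -mulmxA (mulmxA X) XNX.
  - by rewrite NPX.
  have -> : P^T *m X *m (N *m P) = P^T *m (X *m N) *m P by rewrite !mulmxA.
  by rewrite trmx_mul [(P^T *m _)^T]trmx_mul XN trmxK mulmxA.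
rewrite /pseudo_inverse; case: xgetP => [X _ MQ_X|noX].
  case: xgetP => [Y _ M_Y|noY].
    by apply: (pseudo_inverse_unique MQ_X); apply: pinv_mul.
  have [] := noY (Q *m X).
  have := @pinv_mul _ Q^T X _ MQ_X.
  by rewrite trmxK -mulmxA QQ' mulmx1; apply.
case: xgetP => [Y _ M_Y|noY]; last by rewrite mulmx0.
by have [] := noX (Q^T *m Y); apply: pinv_mul.
Qed.

Lemma coercive_mx m n k c (M : 'M[R]_(m, n)) (W : 'M[R]_(n, k)) : 0 < c ->
  (forall x : 'cV[R]_n, c * hsnorm x <= hsnorm (M *m x)) ->
  c * hsnorm W <= hsnorm (M *m W).
Proof.
move=> c_gt0 M_ge; rewrite mulrC -ler_pdivlMr// mulrC -[W in leLHS]mul1mx.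
apply: hsnorm_cols_le => [|x]; first by rewrite invr_ge0 ltW.
by rewrite mul1mx mulrC ler_pdivlMr// mulrC.
Qed.

(** Coercivity makes the Gram matrix [M^T M] injective, and [(M^T M)^-1 M^T] is a solution. *)
Lemma coercive_pseudo_inverse m n c (M : 'M[R]_(m, n)) : 0 < c ->
  (forall x : 'cV[R]_n, c * hsnorm x <= hsnorm (M *m x)) ->
  is_pseudo_inverse M (pseudo_inverse M).
Proof.
move=> c_gt0 M_ge.
have G_sym : (M^T *m M)^T = M^T *m M by rewrite trmx_mul trmxK.
have G_unit : M^T *m M \in unitmx.
  rewrite -row_free_unit -kermx_eq0; apply/eqP/row_matrixP => i; rewrite row0.
  set v := row i _; have vG : v *m (M^T *m M) = 0 by apply/sub_kermxP; exact: row_sub.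
  have Mv : M *m v^T = 0.
    apply: hsdot_eq0; rewrite hsdot_mull mulmxA -[M^T *m M]G_sym -trmx_mul vG trmx0.
    by rewrite /hsdot mulmx0 mxtrace0.
  have := M_ge v^T; rewrite Mv hsnorm0 pmulr_rle0// => v_le0.
  by rewrite -[v]trmxK [v^T]hsnorm_eq0 ?trmx0//; apply: le_anti; rewrite v_le0 hsnorm_ge0.
apply: (xgetPex 0); exists (invmx (M^T *m M) *m M^T).
have XM : invmx (M^T *m M) *m M^T *m M = 1%:M by rewrite -mulmxA mulVmx.
split.
- by rewrite -mulmxA XM mulmx1.
- by rewrite XM mul1mx.
- by rewrite !trmx_mul trmxK trmx_inv G_sym mulmxA.
by rewrite XM trmx1.
Qed.

Lemma coercive_pseudo_inverseK m n c (M : 'M[R]_(m, n)) : 0 < c ->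
  (forall x : 'cV[R]_n, c * hsnorm x <= hsnorm (M *m x)) ->
  pseudo_inverse M *m M = 1%:M.
Proof.
move=> c_gt0 M_ge; have [MXM _ _ _] := coercive_pseudo_inverse c_gt0 M_ge.
have : c * hsnorm (pseudo_inverse M *m M - 1%:M) <= 0.
  by apply: le_trans (coercive_mx _ c_gt0 M_ge) _;
    rewrite mulmxBr mulmxA MXM mulmx1 subrr hsnorm0.
rewrite pmulr_rle0// => h; apply/eqP; rewrite -subr_eq0; apply/eqP/hsnorm_eq0.
by apply: le_anti; rewrite h hsnorm_ge0.
Qed.

(** With [X] the pseudo-inverse, [M X] is an orthogonal projector, so
    [c |X W| <= |M X W| <= |W|]. *)
Lemma coercive_pseudo_inverse_le m n k c (M : 'M[R]_(m, n)) (W : 'M[R]_(m, k)) : 0 < c ->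
  (forall x : 'cV[R]_n, c * hsnorm x <= hsnorm (M *m x)) ->
  c * hsnorm (pseudo_inverse M *m W) <= hsnorm W.
Proof.
move=> c_gt0 M_ge; have [MXM XMX MX _] := coercive_pseudo_inverse c_gt0 M_ge.
apply: le_trans (coercive_mx _ c_gt0 M_ge) _; rewrite mulmxA.
set N := M *m _ *m W.
have [->|/hsnorm_gt0 N_gt0] := eqVneq N 0; first by rewrite hsnorm0 hsnorm_ge0.
rewrite -(ler_pM2r N_gt0) -expr2 hsnorm_sqr {1}/N hsdot_mull MX /N !mulmxA MXM.
exact: hsdot_le.
Qed.

End PseudoInverse.

(** * Perturbation of truncated singular value decompositions *)

Lemma hsnorm_diag_le (R : realType) d k (t : 'rV[R]_d) b (W : 'M[R]_(d, k)) :
  0 <= b -> (forall i, 0 <= t 0 i <= b) -> hsnorm (diag_mx t *m W) <= b * hsnorm W.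
Proof.
move=> b_ge0 t_b; rewrite -hsnormZ// hsnorm_le !hsdotE.
apply: ler_sum => i _; apply: ler_sum => j _; rewrite mul_diag_mx !mxE.
have /andP[t_ge0 t_le] := t_b i.
by rewrite -!expr2 !exprMn ler_wpM2r ?sqr_ge0// ler_sqr ?nnegrE.
Qed.

Lemma hsnorm_diag_ge (R : realType) d k (t : 'rV[R]_d) b (W : 'M[R]_(d, k)) :
  0 <= b -> (forall i, b <= t 0 i) -> b * hsnorm W <= hsnorm (diag_mx t *m W).
Proof.
move=> b_ge0 t_b; rewrite -hsnormZ// hsnorm_le !hsdotE.
apply: ler_sum => i _; apply: ler_sum => j _; rewrite mul_diag_mx !mxE.
by rewrite -!expr2 !exprMn ler_wpM2r ?sqr_ge0// ler_sqr ?nnegrE ?(le_trans b_ge0).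
Qed.

(** The trailing terms are orthogonal to the leading ones, so they disappear under [U^T] on the left
    or [V] on the right. *)
Lemma truncated_svd_factors (R : realType) m n k (M : 'M[R]_(m, n)) U (s : 'rV_k) V :
  is_truncated_svd M U s V ->
  [/\ U^T *m U = 1%:M, V^T *m V = 1%:M, forall i, 0 <= s 0 i,
      U^T *m M = diag_mx s *m V^T & M *m V = U *m diag_mx s].
Proof.
case=> l [U' [s' [V' [UU VV s_ge0 s_sorted ->]]]].
move: UU VV; rewrite !tr_row_mx !mul_col_row !(scalar_mx_block k l 1).
move=> /eq_block_mx[UU UU' U'U U'U'] /eq_block_mx[VV VV' V'V V'V'].
have -> : row_mx U U' *m diag_mx (row_mx s s') *m col_mx V^T V'^T =
    U *m diag_mx s *m V^T + U' *m diag_mx s' *m V'^T.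
  by rewrite diag_mx_row mul_row_block !mulmx0 addr0 add0r mul_row_col.
split=> //.
- by move=> i; have := s_ge0 (lshift l i); rewrite row_mxEl.
- by rewrite mulmxDr !mulmxA UU UU' mul1mx !mul0mx addr0.
by rewrite mulmxDl -!mulmxA VV V'V mulmx1 !mulmx0 addr0.
Qed.

(* The test vector lies in the span of the [d.+1] columns of [V0] and is
   orthogonal to the first [d] columns of [V]. *)
Lemma truncated_svd_weyl (R : realType) m n d (M0 M : 'M[R]_(m, n))
    U0 (s0 : 'rV_d.+1) V0 U (s : 'rV_d.+1) V eps :
  is_svd M0 U0 s0 V0 -> is_truncated_svd M U s V ->
  (forall x : 'cV[R]_n, hsnorm ((M - M0) *m x) <= eps * hsnorm x) ->
  s0 0 ord_max <= s 0 ord_max + eps /\ forall i, s 0 ord_max <= s 0 i.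
Proof.
case=> UU0 VV0 s0_ge0 s0_sorted M0E [l [U' [s' [V' [UU VV s_ge0 s_sorted ME]]]]] M_eps.
split; last first.
  move=> i; have := s_sorted (lshift l i) (lshift l ord_max).
  by rewrite !row_mxEl; apply; rewrite /= -ltnS.
(* Orthogonality to the first [d] columns of [V] is [d] equations in [d.+1] unknowns, so a nonzero
   [y] exists. *)
pose A : 'M[R]_(d, d.+1) := \matrix_(i, j) (V^T *m V0) (widen_ord (leqnSn d) i) j.
have [y y_neq0 Ay] : exists2 y : 'cV[R]_d.+1, y != 0 & A *m y = 0.
  have : kermx A^T != 0.
    rewrite -mxrank_eq0 mxrank_ker -lt0n subn_gt0.
    by apply: leq_ltn_trans (rank_leq_col _) _.
  move=> /rowV0Pn[v /sub_kermxP vA v_neq0]; exists v^T; first by rewrite trmx_eq0.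
  by rewrite -[A]trmxK -trmx_mul vA trmx0.
have y_gt0 := hsnorm_gt0 y_neq0.
pose x := V0 *m y; have x_y : hsnorm x = hsnorm y by rewrite hsnorm_isom.
have M0x : s0 0 ord_max * hsnorm y <= hsnorm (M0 *m x).
  rewrite M0E /x -!mulmxA (mulmxA V0^T) VV0 mul1mx hsnorm_isom//.
  by apply: hsnorm_diag_ge => // i; apply: s0_sorted; rewrite -ltnS.
have s_max : 0 <= s 0 ord_max by have := s_ge0 (lshift l ord_max); rewrite row_mxEl.
have Mx : hsnorm (M *m x) <= s 0 ord_max * hsnorm y.
  rewrite ME -!mulmxA hsnorm_isom//.
  set w := (row_mx V V')^T *m x.
  have w_le : hsnorm w <= hsnorm y by rewrite -x_y hsnorm_isom_tr.
  have w0 (i : 'I_(d.+1 + l)) : (i < d)%N -> w i 0 = 0.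
    move=> i_lt; have [k ->] : exists k, i = lshift l (widen_ord (leqnSn d) k).
      by exists (Ordinal i_lt); apply: val_inj.
    suff -> : w (lshift l (widen_ord (leqnSn d) k)) 0 = (A *m y) k 0 by rewrite Ay mxE.
    rewrite /w /x tr_row_mx mul_col_mx col_mxEu mulmxA !mxE.
    by apply: eq_bigr => j _; rewrite [in RHS]mxE.
  clearbody w; apply: le_trans (ler_wpM2l s_max w_le).
  rewrite -hsnormZ// hsnorm_le !hsdotE; apply: ler_sum => i _.
  apply: ler_sum => j _; rewrite mul_diag_mx !mxE (ord1 j){j}.
  (* The coordinates of [w] before [d] vanish; from [d] on, the singular values are at most
     [s 0 ord_max]. *)
  have [i_lt|i_ge] := ltnP i d.
    by rewrite w0// !mulr0.
  have := s_sorted (lshift l ord_max) i i_ge; have := s_ge0 i.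
  rewrite row_mxEl [row_mx _ _ _ _]mxE => si_ge0 si_le.
  by rewrite -!expr2 !exprMn ler_wpM2r ?sqr_ge0// ler_sqr ?nnegrE.
rewrite -(ler_pM2r y_gt0) mulrDl; apply: le_trans M0x _.
have -> : M0 *m x = M *m x - (M - M0) *m x by rewrite mulmxBl opprB addrC subrK.
apply: le_trans (hsnorm_triangle _ _) _; rewrite hsnormN; apply: lerD => //.
by rewrite -x_y.
Qed.

Lemma truncated_svd_ge (R : realType) m n d (M0 M : 'M[R]_(m, n))
    U0 (s0 : 'rV_d) V0 U (s : 'rV_d) V eps c :
  is_svd M0 U0 s0 V0 -> is_truncated_svd M U s V ->
  (forall x : 'cV[R]_n, hsnorm ((M - M0) *m x) <= eps * hsnorm x) ->
  (forall i, c <= s0 0 i) -> forall i, c - eps <= s 0 i.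
Proof.
case: d U0 s0 V0 U s V => [|d] U0 s0 V0 U s V svd0 tsvd M_eps s0_ge i; first by case: i.
have [weyl s_last] := truncated_svd_weyl svd0 tsvd M_eps.
by apply: le_trans (s_last i); rewrite lerBlDr (le_trans (s0_ge _) weyl).
Qed.

Lemma obs_mul_ctrl (R : realType) m n d (U : 'M[R]_(m, d)) (s : 'rV_d)
    (V : 'M[R]_(n, d)) :
  (forall i, 0 <= s 0 i) ->
  obs_factor U s *m ctrl_factor s V = U *m diag_mx s *m V^T.
Proof.
by move=> s_ge0; rewrite /obs_factor /ctrl_factor mulmxA -(mulmxA U) diag_sqrtK.
Qed.

Lemma truncated_obs_coercive (R : realType) m n d a m' (M0 M : 'M[R]_(m, n))
    U0 (s0 : 'rV_d) V0 U (s : 'rV_d) V (eps sigma c : R) :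
  is_svd M0 U0 s0 V0 -> is_truncated_svd M U s V ->
  (forall x : 'cV[R]_n, hsnorm ((M - M0) *m x) <= eps * hsnorm x) ->
  0 <= eps -> 0 < sigma -> (forall i, sigma <= s 0 i) -> 0 <= c ->
  (forall y : 'cV[R]_d, c * hsnorm y <= hsnorm (subrows a m' (obs_factor U0 s0) *m y)) ->
  forall x : 'cV[R]_d,
    (c * ((1 - eps / sigma) / Num.sqrt (1 + eps / sigma)) - eps / Num.sqrt sigma)
      * hsnorm x <= hsnorm (subrows a m' (obs_factor U s) *m x).
Proof.
case=> UU0 VV0 s0_ge0 _ M0E /truncated_svd_factors[UU VV s_ge0 UM MV] M_eps.
move=> eps_ge0 sigma_gt0 s_sigma c_ge0 O0_ge x.
pose delta := eps / sigma; have delta_ge0 : 0 <= delta by rewrite divr_ge0// ltW.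
pose g := diag_mx (map_mx Num.sqrt s).
pose h := diag_mx (map_mx (fun t => (Num.sqrt t)^-1) s).
have s_gt0 i : 0 < s 0 i by apply: lt_le_trans (s_sigma i).
have g_sym : g^T = g by rewrite tr_diag_mx.
have h_sym : h^T = h by rewrite tr_diag_mx.
have gg : g *m g = diag_mx s by rewrite diag_sqrtK.
have gh : g *m h = 1%:M.
  rewrite mulmx_diag -diag_const_mx; congr diag_mx; apply/rowP => i.
  by rewrite !mxE mulfV// gt_eqF// sqrtr_gt0.
have hg : h *m g = 1%:M by rewrite diag_mxC.
have h_le k (W : 'M[R]_(d, k)) : hsnorm (h *m W) <= (Num.sqrt sigma)^-1 * hsnorm W.
  apply: hsnorm_diag_le => [|i]; first by rewrite invr_ge0 sqrtr_ge0.
  by rewrite mxE invr_ge0 sqrtr_ge0 lef_pV2 ?posrE ?sqrtr_gt0// ler_wsqrtr.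
set O0 := obs_factor U0 s0 in O0_ge *.
pose C0 := ctrl_factor s0 V0.
have OC : M0 = O0 *m C0.
  by rewrite M0E obs_mul_ctrl.
have sqrt_sigma : Num.sqrt sigma ^+ 2 = sigma by rewrite sqr_sqrtr// ltW.
have sqrt_sigma_gt0 : 0 < Num.sqrt sigma by rewrite sqrtr_gt0.
(* These choices give [M v = obs_factor U s *m x] and [hsdot (M v) u = |x|^2], while both vectors
   have norm at most [|x| / sqrt sigma]. *)
pose u := U *m (h *m x); pose v := V *m (h *m x).
have u_norm : hsnorm u <= (Num.sqrt sigma)^-1 * hsnorm x by rewrite hsnorm_isom.
have v_norm : hsnorm v <= (Num.sqrt sigma)^-1 * hsnorm x by rewrite hsnorm_isom.
have Mv : M *m v = obs_factor U s *m x.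
  by rewrite /v mulmxA MV -gg /obs_factor -/g -!mulmxA (mulmxA g h) gh mul1mx.
have Ev : hsnorm ((M - M0) *m v) <= eps / Num.sqrt sigma * hsnorm x.
  by apply: le_trans (M_eps _) _; rewrite -mulrA ler_wpM2l.
have M0vu : (1 - delta) * hsdot x x <= hsdot (M0 *m v) u.
  have -> : M0 *m v = M *m v - (M - M0) *m v by rewrite mulmxBl opprB addrC subrK.
  rewrite hsdotDl hsdotNl Mv /obs_factor -/g -mulmxA hsdot_mull /u mulmxA UU mul1mx.
  rewrite hsdot_mull g_sym mulmxA gh mul1mx mulrBl mul1r lerD2l lerN2 -/u.
  apply: le_trans (hsdot_le _ _) _; rewrite -hsnorm_sqr.
  apply: le_trans (ler_pM (hsnorm_ge0 _) (hsnorm_ge0 _) Ev u_norm) _.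
  rewrite le_eqVlt; apply/orP; left; apply/eqP; rewrite /delta -{3}sqrt_sigma.
  by field; rewrite gt_eqF.
have O0u : hsnorm (O0^T *m u) <= Num.sqrt (1 + delta) * hsnorm x.
  have dd : Num.sqrt (1 + delta) ^+ 2 = 1 + delta by rewrite sqr_sqrtr// addr_ge0.
  rewrite -(@ler_pXn2r _ 2) ?nnegrE ?mulr_ge0 ?sqrtr_ge0 ?hsnorm_ge0//.
  rewrite exprMn dd !hsnorm_sqr.
  (* Conjugation by [g] turns [K] into [U^T O0 O0^T U h^2], which is easy to bound in norm but not
     symmetric. Eigenvalues survive this conjugation, so it is enough to bound them: [z = g y]
     satisfies [lam |z| <= |z| + eps |t|] with [|t| <= |z| / sigma]. *)
  pose K := h *m U^T *m O0 *m O0^T *m U *m h.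
  have -> : hsdot (O0^T *m u) (O0^T *m u) = hsdot x (K *m x).
    by rewrite hsdot_mull trmxK hsdot_mull hsdot_mull h_sym /K !mulmxA.
  apply: sym_form_le => [|lam y y_neq0 yE].
    by rewrite /K !trmx_mul !trmxK h_sym !mulmxA.
  have [lam_le0|/ltW lam_ge0] := lerP lam 0.
    by apply: le_trans lam_le0 _; rewrite addr_ge0.
  pose z := g *m y; have y_z : y = h *m z by rewrite /z mulmxA hg mul1mx.
  have z_gt0 : 0 < hsnorm z.
    by apply: hsnorm_gt0; apply: contra y_neq0 => /eqP z0; rewrite y_z z0 mulmx0.
  pose t := U *m (h *m (h *m z)).
  have zE : lam *: z = U^T *m (U0 *m (V0^T *m (M0^T *m t))).
    have -> : V0^T *m (M0^T *m t) = diag_mx s0 *m (U0^T *m t).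
      by rewrite M0E !trmx_mul trmxK tr_diag_mx !mulmxA VV0 mul1mx.
    rewrite /z scalemxAr -yE /K !mulmxA gh mul1mx -!mulmxA /t -y_z.
    congr (_ *m _); rewrite /O0 /obs_factor trmx_mul tr_diag_mx.
    by rewrite -(diag_sqrtK s0_ge0) !mulmxA.
  have M0t : M0^T *m t = V *m z - (M - M0)^T *m t.
    have -> : V *m z = M^T *m t.
      have -> : M^T *m t = (U^T *m M)^T *m (h *m (h *m z)).
        by rewrite trmx_mul trmxK -mulmxA.
      rewrite UM trmx_mul trmxK tr_diag_mx -gg -!mulmxA (mulmxA g h) gh mul1mx.
      by rewrite (mulmxA g h) gh mul1mx.
    by rewrite linearB/= mulmxBl opprB addrC subrK.
  rewrite -(ler_pM2r z_gt0) -hsnormZ// zE.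
  apply: le_trans (hsnorm_isom_tr _ UU) _; rewrite hsnorm_isom//.
  apply: le_trans (hsnorm_isom_tr _ VV0) _; rewrite M0t.
  apply: le_trans (hsnorm_triangle _ _) _; rewrite hsnormN hsnorm_isom// mulrDl mul1r.
  rewrite lerD2l; apply: le_trans (hsnorm_mul_le_tr eps_ge0 M_eps _) _.
  rewrite /delta -mulrA ler_wpM2l// /t hsnorm_isom//.
  apply: le_trans (h_le _ _) _; rewrite -[sigma in leRHS]sqrt_sigma expr2 invfM -mulrA.
  by rewrite ler_wpM2l ?invr_ge0 ?sqrtr_ge0.
have C0v : (1 - delta) / Num.sqrt (1 + delta) * hsnorm x <= hsnorm (C0 *m v).
  have [->|x_neq0] := eqVneq x 0; first by rewrite hsnorm0 mulr0 hsnorm_ge0.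
  have dd : 0 < Num.sqrt (1 + delta) by rewrite sqrtr_gt0 ltr_wpDr.
  rewrite mulrAC ler_pdivrMr// -(ler_pM2r (hsnorm_gt0 x_neq0)) -mulrA -expr2 hsnorm_sqr.
  apply: le_trans M0vu _; rewrite OC -mulmxA hsdot_mull.
  apply: le_trans (hsdot_le _ _) _; rewrite -mulrA.
  by rewrite ler_wpM2l ?hsnorm_ge0.
have POx : subrows a m' (obs_factor U s) *m x =
    subrows a m' O0 *m (C0 *m v) + subrows a m' ((M - M0) *m v).
  rewrite -!subrows_mul -Mv mulmxA -OC mulmxBl subrowsB addrC subrK//.
have h1 : c * ((1 - delta) / Num.sqrt (1 + delta)) * hsnorm x <=
    hsnorm (subrows a m' O0 *m (C0 *m v)).
  by apply: le_trans (O0_ge _); rewrite -mulrA ler_wpM2l.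
have h2 : hsnorm (subrows a m' ((M - M0) *m v)) <= eps / Num.sqrt sigma * hsnorm x.
  exact: le_trans (hsnorm_subrows _ _ _) Ev.
have h3 : hsnorm (subrows a m' O0 *m (C0 *m v)) <=
    hsnorm (subrows a m' (obs_factor U s) *m x) + hsnorm (subrows a m' ((M - M0) *m v)).
  have -> : subrows a m' O0 *m (C0 *m v) =
      subrows a m' (obs_factor U s) *m x - subrows a m' ((M - M0) *m v).
    by rewrite POx addrK.
  by apply: le_trans (hsnorm_triangle _ _) _; rewrite hsnormN.
rewrite mulrBl -/delta; lra.
Qed.

(** A decomposition of [M] with [k] terms forces the singular values past the [k]-th to vanish, so
    the truncation discards nothing. *)
Lemma truncated_svd_exact (R : realType) m n k (M : 'M[R]_(m, n)) U0 (s0 : 'rV_k) V0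
    U (s : 'rV_k) V :
  is_svd M U0 s0 V0 -> is_truncated_svd M U s V -> U *m diag_mx s *m V^T = M.
Proof.
move=> M_svd0 [l [U' [s' [V' M_svd]]]].
suff s'0 : s' = 0.
  case: M_svd => _ _ _ _ ->; rewrite s'0 diag_mx_row raddf0 tr_row_mx.
  by rewrite mul_row_block !mulmx0 !addr0 mul_row_col mul0mx addr0.
apply/rowP => j; rewrite mxE -(row_mxEr s s') -(svd_singular_value (rshift k j) M_svd).
rewrite /singular_value (svd_singular_values M_svd0) nth_cat size_map size_enum_ord/=.
by rewrite ltnNge leq_addr/= nth_nseq if_same.
Qed.

(** The padding zeros stay below [t > 0], so all [d] entries of [s] must be among those counted. *)
Lemma svd_pos_of_count (R : realType) m n d (M : 'M[R]_(m, n)) U (s : 'rV_d) V t :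
  is_svd M U s V -> 0 < t -> count (fun x : R => t <= x) (singular_values M) = d ->
  forall i, t <= s 0 i.
Proof.
move=> /svd_singular_values -> t_gt0; rewrite count_cat count_nseq leNgt t_gt0 mul0n addn0.
set l := map _ _; have l_size : size l = d by rewrite size_map size_enum_ord.
rewrite -[RHS]l_size => /eqP; rewrite -all_count => /allP l_ge i.
by apply: l_ge; apply: map_f; rewrite mem_enum.
Qed.

(** * Shift equation of the balanced factor and error of the state matrix *)

Lemma balanced_shift (R : realType) d r p T (A : 'M[R]_d) (B : 'M[R]_(d, r))
    (C : 'M[R]_(p, d)) U (s : 'rV_d) V :
  is_svd (block_hankel T A B C) U s V -> (forall i, 0 < s 0 i) ->
  exists A' : 'M[R]_d, subrows p (T.-1 * p) (obs_factor U s) =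
    subrows 0 (T.-1 * p) (obs_factor U s) *m A'.
Proof.
case=> UU VV s_ge0 _ HE s_gt0.
pose h := diag_mx (map_mx (fun t => (Num.sqrt t)^-1) s).
have gh : diag_mx (map_mx Num.sqrt s) *m h = 1%:M.
  rewrite mulmx_diag -diag_const_mx; congr diag_mx; apply/rowP => i.
  by rewrite !mxE mulfV// gt_eqF// sqrtr_gt0.
have hg : h *m diag_mx (map_mx Num.sqrt s) = 1%:M by rewrite diag_mxC.
(* [S] is the change of state basis to balanced coordinates and [L] its inverse; the shift equation
   is transported with [A' = L A S]. *)
pose S := controllability T A B *m V *m h.
pose L := h *m U^T *m observability T A C.
have OS : obs_factor U s = observability T A C *m S.
  rewrite /S !mulmxA -block_hankel_factor HE -(obs_mul_ctrl _ _ s_ge0) /ctrl_factor.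
  by rewrite -!mulmxA (mulmxA V^T) VV mul1mx gh mulmx1.
have SL : S *m L = 1%:M.
  apply: mulmx1C.
  by rewrite /L -(mulmxA (h *m U^T)) -OS /obs_factor !mulmxA -(mulmxA h) UU mulmx1.
clearbody S L; exists (L *m A *m S).
by rewrite OS !subrows_mul observability_shift !mulmxA -(mulmxA _ S) SL mulmx1.
Qed.

(* With [eps <= 0.228 sO sqrt sH] and [sO <= sqrt sH] the right-hand side is at
   least [0.358 sO], while [1 / (2 sqrt 2) < 0.354]. *)
Lemma coercivity_constant (R : realType) (sO sH : R) :
  0 < sO -> 0 < sH -> sO <= Num.sqrt sH ->
  let eps := Num.sqrt (Num.sqrt 2 - 1) * sO * Num.sqrt sH / (2 * Num.sqrt 2) in
  0 < sH - eps /\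
  sO / (2 * Num.sqrt 2) <=
  sO * ((1 - eps / (sH - eps)) / Num.sqrt (1 + eps / (sH - eps)))
    - eps / Num.sqrt (sH - eps).
Proof.
move=> sO_gt0 sH_gt0 sO_le eps; set sigma := sH - eps.
set b := Num.sqrt sH in sO_le eps sigma *.
have b_gt0 : 0 < b by rewrite sqrtr_gt0.
have bb : b ^+ 2 = sH by rewrite sqr_sqrtr// ltW.
have a_ge0 : 0 <= Num.sqrt 2 :> R by rewrite sqrtr_ge0.
have aa : Num.sqrt 2 ^+ 2 = 2 :> R by rewrite sqr_sqrtr.
have sq_le (x y : R) : 0 <= x -> 0 <= y -> x ^+ 2 <= y ^+ 2 -> x <= y.
  by move=> x_ge0 y_ge0; rewrite ler_pXn2r.
have a_le : Num.sqrt 2 <= (1415 / 1000) :> R by apply: sq_le; lra.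
have a_ge : (1413 / 1000) <= Num.sqrt 2 :> R by apply: sq_le; lra.
(* The constant in [eps = c0 sO sqrt sH]; its value is about 0.2276. *)
pose c0 : R := Num.sqrt (Num.sqrt 2 - 1) / (2 * Num.sqrt 2).
have c0_ge0 : 0 <= c0 by rewrite divr_ge0 ?sqrtr_ge0// mulr_ge0.
have c0_le : c0 <= (228 / 1000).
  rewrite ler_pdivrMr; last lra.
  apply: sq_le; [exact: sqrtr_ge0|lra|].
  rewrite sqr_sqrtr; last lra.
  rewrite !exprMn aa; lra.
have epsE : eps = c0 * (sO * b) by rewrite /eps /c0; field; lra.
have sOb : 0 < sO * b by rewrite mulr_gt0.
have eps_ge0 : 0 <= eps by rewrite epsE mulr_ge0// ltW.
have eps_le : eps <= (228 / 1000) * (sO * b) by rewrite epsE ler_wpM2r// ltW.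
have sOb_le : sO * b <= sH by rewrite -bb expr2 ler_wpM2r// ltW.
(* Here 0.772 = 1 - 0.228. The later decimals are roundings: 0.878 of sqrt 0.772, 0.26 of 0.228 /
   0.878, 0.296 of 0.228 / 0.772, 1.139 of sqrt 1.296, and 0.618 of 0.704 / 1.139. *)
have sigma_ge : (772 / 1000) * sH <= sigma by rewrite /sigma; lra.
have sigma_gt0 : 0 < sigma by lra.
clear a_le aa c0_le.
split=> //.
have t_ge : (878 / 1000) * b <= Num.sqrt sigma.
  apply: sq_le; [lra|exact: sqrtr_ge0|].
  rewrite sqr_sqrtr; last lra.
  rewrite exprMn bb; lra.
have t_gt0 : 0 < Num.sqrt sigma by lra.
clear bb.
have h1 : eps / Num.sqrt sigma <= (26 / 100) * sO.
  rewrite ler_pdivrMr//; apply: le_trans eps_le _.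
  have := ler_wpM2l (ltW sO_gt0) t_ge; lra.
have h2 : eps / sigma <= (296 / 1000) by rewrite ler_pdivrMr//; lra.
have h2' : 0 <= eps / sigma by rewrite divr_ge0// ltW.
clear t_ge t_gt0 eps_le sigma_ge.
have h3 : Num.sqrt (1 + eps / sigma) <= (1139 / 1000).
  apply: sq_le; [exact: sqrtr_ge0|lra|].
  rewrite sqr_sqrtr; lra.
have h3' : 0 < Num.sqrt (1 + eps / sigma) by rewrite sqrtr_gt0; lra.
have h4 : (618 / 1000) <= (1 - eps / sigma) / Num.sqrt (1 + eps / sigma).
  rewrite ler_pdivlMr//; lra.
have h5 : sO / (2 * Num.sqrt 2) <= (354 / 1000) * sO.
  rewrite ler_pdivrMr; last lra.
  have := ler_wpM2l (ltW sO_gt0) a_ge; lra.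
have := ler_wpM2l (ltW sO_gt0) h4; move: sO_gt0 h1 h5; clear; lra.
Qed.

(** [A'] places the shifted block of [O] in the column space of [obs_plus O], so [A = realize_A O]
    solves the shift equation exactly. Hence [Q^T A Q] solves it for [O Q], and its residual for
    [Oh] involves only [Oh - O Q]: one shifted block, and one block multiplied by [Q^T A Q]. *)
Lemma realize_A_perturbation (R : realType) p T d (O Oh : 'M[R]_(T * p, d)) (Q A' : 'M[R]_d)
    (b c : R) :
  Q^T *m Q = 1%:M ->
  0 < b -> (forall x : 'cV[R]_d, b * hsnorm x <= hsnorm (obs_plus O *m x)) ->
  0 < c -> (forall x : 'cV[R]_d, c * hsnorm x <= hsnorm (obs_plus Oh *m x)) ->
  subrows p (T.-1 * p) O = obs_plus O *m A' ->
  c * hsnorm (realize_A Oh - Q^T *m realize_A O *m Q) <=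
  (1 + opnorm (realize_A O)) * hsnorm (Oh - O *m Q).
Proof.
move=> QQ b_gt0 O_ge c_gt0 Oh_ge O_shift; have QQ' := mulmx1C QQ.
set A := realize_A O; set D := hsnorm (Oh - O *m Q).
have OA : obs_plus O *m A = subrows p (T.-1 * p) O.
  have [MXM _ _ _] := coercive_pseudo_inverse b_gt0 O_ge.
  by rewrite /A /realize_A O_shift !mulmxA MXM.
have -> : realize_A Oh - Q^T *m A *m Q =
    pseudo_inverse (obs_plus Oh) *m
    (subrows p (T.-1 * p) Oh - obs_plus Oh *m (Q^T *m A *m Q)).
  by rewrite mulmxBr (mulmxA _ (obs_plus Oh)) (coercive_pseudo_inverseK c_gt0 Oh_ge) mul1mx.
apply: le_trans (coercive_pseudo_inverse_le _ c_gt0 Oh_ge) _.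
have -> : subrows p (T.-1 * p) Oh - obs_plus Oh *m (Q^T *m A *m Q) =
    subrows p (T.-1 * p) (Oh - O *m Q) - obs_plus (Oh - O *m Q) *m (Q^T *m A *m Q).
  rewrite /obs_plus !subrowsB !subrows_mul mulmxBl -!/(obs_plus _).
  rewrite [X in _ - (_ - X)](_ : _ = subrows p (T.-1 * p) O *m Q).
    by rewrite opprB addrA subrK.
  by rewrite -OA !mulmxA -(mulmxA _ Q) QQ' mulmx1.
apply: le_trans (hsnorm_triangle _ _) _; rewrite hsnormN mulrDl mul1r.
apply: lerD; first exact: hsnorm_subrows.
have A_op k (W : 'M[R]_(d, k)) : hsnorm (A *m W) <= opnorm A * hsnorm W.
  apply: hsnorm_mul_le => [|x]; [exact: opnorm_ge0|exact: hsnorm_le_opnorm].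
clearbody A.
rewrite !mulmxA hsnorm_isomr// -hsnorm_tr trmx_mul.
apply: le_trans (hsnorm_mul_le_tr (opnorm_ge0 _) (A_op _) _) _.
rewrite ler_wpM2l ?opnorm_ge0// hsnorm_tr hsnorm_isomr ?trmxK//.
exact: hsnorm_subrows.
Qed.

(** * Assembly of the three estimates *)

Theorem theorem2p4 (R : realType) (d0 r p T : nat)
  (A0 : 'M[R]_d0) (B0 : 'M[R]_(d0, r)) (C0 : 'M[R]_(p, d0))
  (hmin : minimal_realization A0 B0 C0)
  (hT : (d0 + 1 <= T)%N)
  (U0 : 'M[R]_(T * p, d0)) (s0 : 'rV[R]_d0) (V0 : 'M[R]_(T * r, d0))
  (hsvd0 : is_svd (block_hankel T A0 B0 C0) U0 s0 V0)
  (Hhat : 'M[R]_(T * p, T * r)) (xi : R) (hxi : 0 < xi)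
  (dxi : nat)
  (hdxi : dxi = count (fun s : R => 2 * xi <= s) (singular_values Hhat))
  (Uxi : 'M[R]_(T * p, dxi)) (sxi : 'rV[R]_dxi) (Vxi : 'M[R]_(T * r, dxi))
  (hsvdxi : is_truncated_svd Hhat Uxi sxi Vxi)
  (hd : dxi = d0) :
  let H0 := block_hankel T A0 B0 C0 in
  let Obar := obs_factor U0 s0 in
  let Cbar := ctrl_factor s0 V0 in
  let Ohat := obs_factor Uxi sxi in
  let Chat := ctrl_factor sxi Vxi in
  let Hxi := Uxi *m diag_mx sxi *m Vxi^T in
  let sO := singular_value d0 (obs_plus Obar) in
  let sH := singular_value d0 H0 in
  Num.min (opnorm (Hhat - H0)) (hsnorm (Hhat - H0)) <=
    Num.sqrt (Num.sqrt 2 - 1) * sO * Num.sqrt sH / (2 * Num.sqrt 2) ->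
  exists Q : 'M[R]_(d0, dxi),
    (Q^T *m Q = 1%:M /\ Q *m Q^T = 1%:M) /\
    [/\ hsnorm (Ohat - Obar *m Q) ^+ 2 + hsnorm (Chat - Q^T *m Cbar) ^+ 2 <=
          2 / (Num.sqrt 2 - 1) * (hsnorm (Hxi - H0) ^+ 2 / sH),
        hsnorm (realize_C Ohat - realize_C Obar *m Q) ^+ 2 +
        hsnorm (realize_B Chat - Q^T *m realize_B Cbar) ^+ 2 <=
          2 / (Num.sqrt 2 - 1) * (hsnorm (Hxi - H0) ^+ 2 / sH)
      & hsnorm (realize_A Ohat - Q^T *m realize_A Obar *m Q) <=
          Num.sqrt 2 ^+ 3 * (1 + opnorm (realize_A Obar)) /
            (Num.sqrt (Num.sqrt 2 - 1) * sO * Num.sqrt sH) *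
          hsnorm (Hxi - H0)].
Proof.
subst d0 => H0 Obar Cbar Ohat Chat Hxi sO sH.
set eps := _ / (2 * Num.sqrt 2); set E := hsnorm (Hxi - H0) => H_eps.
have a_gt0 : 0 < Num.sqrt 2 - 1 :> R.
  by rewrite subr_gt0 -[ltLHS]sqrtr1 ltr_sqrt// ltr1n.
have sq2_gt0 : 0 < Num.sqrt 2 :> R by rewrite sqrtr_gt0.
have sO_ge0 : 0 <= sO by exact: singular_value_ge0.
have sH_ge0 : 0 <= sH by exact: singular_value_ge0.
have E_ge0 : 0 <= E by exact: hsnorm_ge0.
(* For [dxi = 0] the index [0.-1 = 0] deprives [sH] of its intended meaning, but every norm on the
   left is that of an empty matrix and the bounds are nonnegative. *)
have [d_eq0|d_gt0] := posnP dxi.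
  have mx0 m (M : 'M[R]_(m, dxi)) : hsnorm M = 0.
    rewrite /hsnorm big1 ?sqrtr0// => i _; rewrite big1// => j _.
    by exfalso; have := ltn_ord j; rewrite [in X in (_ < X)%N]d_eq0.
  have mx0' m (M : 'M[R]_(dxi, m)) : hsnorm M = 0 by rewrite -hsnorm_tr mx0.
  have bound_ge0 : 0 <= 2 / (Num.sqrt 2 - 1) * (E ^+ 2 / sH).
    by rewrite !mulr_ge0 ?invr_ge0 ?sqr_ge0 ?(ltW a_gt0).
  exists 1%:M; rewrite trmx1 mulmx1; split=> //.
  rewrite !mx0 !mx0' expr0n addr0; split=> //.
  by rewrite !mulr_ge0 ?invr_ge0 ?mulr_ge0 ?addr_ge0 ?opnorm_ge0 ?exprn_ge0
    ?sqrtr_ge0.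
have eps_ge0 : 0 <= eps.
  by rewrite divr_ge0 ?mulr_ge0 ?sqrtr_ge0.
(* Whichever norm attains the minimum, it dominates the action on vectors. *)
have M_eps (x : 'cV[R]_(T * r)) : hsnorm ((Hhat - H0) *m x) <= eps * hsnorm x.
  move: H_eps; rewrite ge_min => /orP[] /(ler_wpM2r (hsnorm_ge0 x)); apply: le_trans.
    exact: hsnorm_le_opnorm.
  exact: hsnorm_mulcV.
have exact_H : eps = 0 -> Hhat = H0.
  move=> eps0; apply/eqP; rewrite -subr_eq0; apply/eqP/hsnorm_eq0/le_anti.
  rewrite hsnorm_ge0 andbT -[Hhat - H0]mulmx1.
  apply: le_trans (hsnorm_mul_le eps_ge0 M_eps _) _; by rewrite eps0 mul0r.
have last_lt : (dxi.-1 < dxi)%N by rewrite prednK.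
pose last : 'I_dxi := Ordinal last_lt.
have sHE : sH = s0 0 last.
  rewrite -(svd_singular_value last hsvd0) /sH /= prednK//.
have s0_ge i : sH <= s0 0 i.
  rewrite sHE; case: hsvd0 => _ _ _ s0_sorted _; apply: s0_sorted.
  by rewrite /= -ltnS prednK.
have sH_gt0 : 0 < sH.
  rewrite lt_def sH_ge0 andbT; apply/eqP => sH0.
  have HH : Hhat = H0 by apply: exact_H; rewrite /eps sH0 sqrtr0 mulr0 mul0r.
  have xi2_gt0 : 0 < 2 * xi by rewrite mulr_gt0.
  have := svd_pos_of_count hsvd0 xi2_gt0.
  rewrite -/H0 -HH -hdxi => /(_ erefl last); rewrite -sHE sH0 leNgt xi2_gt0//.
have [UU0 VV0 s0_ge0 s0_sorted H0E] := hsvd0.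
have [UU VV s_ge0 _ _] := truncated_svd_factors hsvdxi.
have [Q QQ] := procrustes_svd UU0 VV0 UU VV s0_ge0 s_ge0 s0_ge.
rewrite -H0E -/H0 -/Hxi -/E -/Obar -/Cbar -/Ohat -/Chat.
set D2 := hsnorm _ ^+ 2 + _ => D2_le; have QQ' := mulmx1C QQ.
exists Q; split=> //.
have D2_ge0 : 0 <= D2 by rewrite addr_ge0 ?sqr_ge0.
have D2_le' : D2 <= 2 / (Num.sqrt 2 - 1) * (E ^+ 2 / sH).
  rewrite mulrA ler_pdivlMr// (mulrAC 2) ler_pdivlMr// -mulrA mulrC (mulrC sH).
  apply: le_trans D2_le _.
  by rewrite mulr_natl mulr2n lerDl sqr_ge0.
split=> //.
  apply: le_trans D2_le'; apply: lerD.
    rewrite /realize_C -subrows_mul -subrowsB ler_sqr ?nnegrE ?hsnorm_ge0//.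
    exact: hsnorm_subrows.
  rewrite realize_B_mul realize_B_sub ler_sqr ?nnegrE ?hsnorm_ge0//.
  exact: hsnorm_subcols.
have D_le : Num.sqrt (Num.sqrt 2 - 1) * Num.sqrt sH * hsnorm (Ohat - Obar *m Q) <= E.
  rewrite -(@ler_pXn2r _ 2) ?nnegrE ?mulr_ge0 ?sqrtr_ge0 ?hsnorm_ge0//.
  rewrite !exprMn (sqr_sqrtr sH_ge0) (sqr_sqrtr (ltW a_gt0)); apply: le_trans D2_le.
  by rewrite ler_wpM2l ?mulr_ge0 ?(ltW a_gt0)// lerDl sqr_ge0.
(* Here [eps = 0], so [E = 0] and [D_le] gives [Ohat = Obar Q]; the state matrices are then
   conjugate by [Q]. *)
have [sO0|] := eqVneq sO 0.
  have HH : Hhat = H0 by apply: exact_H; rewrite /eps sO0 mulr0 !mul0r.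
  have E0 : E = 0.
    rewrite /E /Hxi (truncated_svd_exact hsvd0) -/H0 ?subrr ?hsnorm0//.
    by rewrite -HH.
  have OO : Ohat = Obar *m Q.
    apply/eqP; rewrite -subr_eq0; apply/eqP/hsnorm_eq0/le_anti; rewrite hsnorm_ge0 andbT.
    move: D_le; rewrite E0 pmulr_rle0// mulr_gt0// sqrtr_gt0//.
  rewrite E0 mulr0 /realize_A /obs_plus OO !subrows_mul pseudo_inverse_mulr//.
  by rewrite !mulmxA subrr hsnorm0.
rewrite neq_lt ltNge sO_ge0 /= => sO_gt0.
have O_ge (x : 'cV[R]_dxi) : sO * hsnorm x <= hsnorm (obs_plus Obar *m x).
  exact: singular_value_coercive.
have sO_le : sO <= Num.sqrt sH.
  (* On the last basis vector [Obar] has norm exactly [sqrt sH], and dropping rows can only decrease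
     it. *)
  pose e : 'cV[R]_dxi := delta_mx last 0.
  have e1 : hsnorm e = 1.
    apply/eqP; rewrite -(@eqrXn2 _ 2) ?hsnorm_ge0// expr1n hsnorm_sqr.
    rewrite hsdotE; under eq_bigr do rewrite big_ord1.
    rewrite (bigD1 last)//= big1 => [|i i_last].
      by rewrite !mxE !eqxx mulr1 addr0.
    by rewrite !mxE (negPf i_last) mul0r.
  have := O_ge e; rewrite e1 mulr1 => /le_trans; apply.
  rewrite /obs_plus -subrows_mul; apply: le_trans (hsnorm_subrows _ _ _) _.
  rewrite /Obar /obs_factor -mulmxA hsnorm_isom// sHE.
  have -> : diag_mx (map_mx Num.sqrt s0) *m e = Num.sqrt (s0 0 last) *: e.
    apply/matrixP => i j; rewrite mul_diag_mx !mxE.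
    by have [->//|] := eqVneq i last; rewrite !mulr0.
  by rewrite hsnormZ ?sqrtr_ge0// e1 mulr1.
have [sigma_gt0 const_le] := coercivity_constant sO_gt0 sH_gt0 sO_le.
have s_ge i : sH - eps <= sxi 0 i.
  exact: (truncated_svd_ge hsvd0 hsvdxi M_eps s0_ge).
pose c := sO / (2 * Num.sqrt 2).
have c_gt0 : 0 < c by rewrite divr_gt0// mulr_gt0.
have Oh_ge (x : 'cV[R]_dxi) : c * hsnorm x <= hsnorm (obs_plus Ohat *m x).
  apply: le_trans (truncated_obs_coercive hsvd0 hsvdxi M_eps eps_ge0 sigma_gt0 s_ge
    sO_ge0 O_ge x).
  by rewrite ler_wpM2r ?hsnorm_ge0.
have s0_gt0 i : 0 < s0 0 i by apply: lt_le_trans (s0_ge i).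
have [A' A'E] := balanced_shift hsvd0 s0_gt0.
have := realize_A_perturbation QQ sO_gt0 O_ge c_gt0 Oh_ge A'E.
set LHS := hsnorm (realize_A Ohat - _); set N := opnorm _ => h.
have N_ge0 : 0 <= 1 + N by rewrite addr_ge0 ?opnorm_ge0.
have b_gt0 : 0 < Num.sqrt (Num.sqrt 2 - 1) * Num.sqrt sH :> R.
  by rewrite mulr_gt0 ?sqrtr_gt0.
(* Since [sqrt 2 ^ 3 = 2 sqrt 2], the constant splits into [1 / c], from the lower bound on
   [obs_plus Ohat], and the factor that [D_le] provides. *)
have -> : Num.sqrt 2 ^+ 3 * (1 + N) / (Num.sqrt (Num.sqrt 2 - 1) * sO * Num.sqrt sH) * E =
    c^-1 * ((1 + N) * (E / (Num.sqrt (Num.sqrt 2 - 1) * Num.sqrt sH))).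
  rewrite exprS sqr_sqrtr// /c; field.
  by rewrite !gt_eqF ?sqrtr_gt0.
rewrite mulrC ler_pdivlMr// mulrC; apply: le_trans h _.
rewrite ler_wpM2l// ler_pdivlMr// mulrC//.
Qed.
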